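(* Let $\alpha\in(0,1]$, let $\Omega\subset\mathbb{C}$ be a $C^{2,\alpha}$ Jordan domain, and let $\rho(\zeta)|d\zeta|$ be a conformal $C^1$-metric on $\Omega$ such that $\rho$ is approximately analytic in $\Omega$. Let $K\ge1$, $K'\ge0$, and suppose that $w$ is a $\rho$-harmonic mapping of $\mathbb{D}$ onto $\Omega$ which is a proper $(K,K')$-quasiregular mapping. Then $w$ has bounded partial derivatives in $\mathbb{D}$. In particular, $w$ is Lipschitz continuous, i.e. there is a constant $L$ such that $|w(z_1)-w(z_2)|\le L|z_1-z_2|$ for all $z_1,z_2\in\mathbb{D}$.
   Context: $\mathbb{D}=\{z\in\mathbb{C}:|z|<1\}$. A Jordan domain is a domain in $\mathbb{C}$ whose boundary is a Jordan curve; all Jordan domains are assumed bounded. A rectifiable Jordan curve $\gamma$ of length $\ell(\gamma)$ with arc-length parameterization $\Gamma:[0,\ell(\gamma)]\to\gamma$ is of class $C^{n,\alpha}$ ($n\in\mathbb{N}$, $\alpha\in(0,1]$) if $\Gamma$ is of class $C^n$ and $\sup_{t\ne s}\frac{|\Gamma^{(n)}(t)-\Gamma^{(n)}(s)|}{|t-s|^{\alpha}}<\infty$. A $C^{n,\alpha}$ Jordan domain is one whose boundary is a $C^{n,\alpha}$ Jordan curve. A $C^1$ function $h$ is approximately analytic if there is a constant $C\ge0$ such that $|h_{\bar z}|\le C|h|$ throughout its domain. For a conformal $C^1$-metric $\rho(\zeta)|d\zeta|$ on $\Omega$ (so $\rho>0$ is of class $C^1$), a twice continuously differentiable complex-valued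 function $f:D\to\Omega$ between plane domains is $\rho$-harmonic if $f_{z\bar z}+\big((\log\rho)_\zeta\circ f\big)f_zf_{\bar z}=0$ in $D$. $\nabla w$ denotes the Jacobian matrix of $w$ with operator norm $|\nabla w|=|w_z|+|w_{\bar z}|$, and $J_w=|w_z|^2-|w_{\bar z}|^2$. A function $w$ on a domain $D$ is ACL if for every closed rectangle $R\subset D$ with sides parallel to the axes, $w$ is absolutely continuous on almost every horizontal and almost every vertical line in $R$; it is $ACL^2$ if in addition its partial derivatives are locally $L^2$-integrable in $D$. For constants $K\ge1$, $K'\ge0$, a sense-preserving continuous mapping $w:D\to\Omega$ is $(K,K')$-quasiregular if $w$ is $ACL^2$ in $D$, $J_w\neq0$ a.e. in $D$, and $|\nabla w|^2\le KJ_w+K'$ (a.e. in $D$). A mapping $f:D\to\Omega$ is proper if the preimage of every compact subset of $\Omega$ is compact in $D$. *)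

(* Defs.v *)
From HB Require Import structures.
From mathcomp Require Import all_boot all_order all_algebra.
From mathcomp Require Import complex.
From mathcomp Require Import all_classical all_reals all_analysis.

Set Implicit Arguments.
Unset Strict Implicit.
Unset Printing Implicit Defensive.

Import Order.TTheory GRing.Theory Num.Theory.
Import numFieldNormedType.Exports.

Local Open Scope classical_set_scope.
Local Open Scope ring_scope.
Local Open Scope complex_scope.

(** The complex plane is [R * R], which carries the product topology, the real
    normed-module structure used for derivatives, and two-dimensional Lebesgue
    measure; [cplx] and [plane_of] pass to and from the field [R[i]].  The
    library norm on [R * R] is the maximum norm, so the complex modulus is
    always written [cabs].  Maps of a domain are total functions on the plane,
    used only on that domain. *)

Local Notation normc := complex.ComplexField.Normc.normc.

Section Plane.
Context {R : realType}.
Implicit Types (z : R * R) (D : set (R * R)).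

Definition cplx z : R[i] := z.1 +i* z.2.
Definition plane_of (c : R[i]) : R * R := (complex.Re c, complex.Im c).
Definition cabs z : R := normc (cplx z).

Definition unit_disc : set (R * R) := [set z | cabs z < 1].

Definition plane_domain D := [/\ open D, connected D & D !=set0].

Definition boundary D : set (R * R) := closure D `\` interior D.

Section Smoothness.
Context {V : normedModType R}.

Definition dx (f : R * R -> V) z : V := 'D_((1, 0) : R * R) f z.
Definition dy (f : R * R -> V) z : V := 'D_((0, 1) : R * R) f z.

Fixpoint class_C (n : nat) D (f : R * R -> V) : Prop :=
  (forall z, D z -> {for z, continuous f}) /\
  match n with
  | 0 => True
  | m.+1 =>
      [/\ forall z, D z -> derivable f z ((1, 0) : R * R) /\
                           derivable f z ((0, 1) : R * R),
          class_C m D (dx f)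
        & class_C m D (dy f)]
  end.

Definition line_class_C (n : nat) (g : R -> V) : Prop :=
  (forall k, (k < n)%N -> forall t, derivable (derive1n k g) t 1) /\
  (forall k, (k <= n)%N -> continuous (derive1n k g)).

End Smoothness.

(** Wirtinger derivatives [f_z] and [f_zbar] of a complex-valued function. *)
Definition d_z (f : R * R -> R * R) z : R[i] :=
  (cplx (dx f z) - 'i * cplx (dy f z)) / 2%:R.
Definition d_zbar (f : R * R -> R * R) z : R[i] :=
  (cplx (dx f z) + 'i * cplx (dy f z)) / 2%:R.

Definition real_valued (h : R * R -> R) : R * R -> R * R := fun z => (h z, 0).

Definition arc_length (G : R -> R * R) (a b : R) : \bar R :=
  ereal_sup [set (\sum_(i < size s)
                    cabs (G (nth b (a :: s) i.+1) - G (nth b (a :: s) i)))%:E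
            | s in itv_partition a b].

Definition Jordan_loop (l : R) (G : R -> R * R) (gamma : set (R * R)) :=
  [/\ 0 < l,
      continuous G,
      forall t, G (t + l) = G t,
      forall s t, 0 <= s < l -> 0 <= t < l -> G s = G t -> s = t
    & gamma = G @` [set t | 0 <= t <= l]].

(** [G] is the arc-length parameterization of the Jordan curve [gamma] of
    length [l], extended [l]-periodically to the line, so that smoothness of
    [G] includes smoothness at the base point [G 0 = G l]. *)
Definition arc_length_param (l : R) (G : R -> R * R) (gamma : set (R * R)) :=
  Jordan_loop l G gamma /\
  forall s t, 0 <= s -> s <= t -> t <= l -> arc_length G s t = (t - s)%:E.

Definition Cna_Jordan_curve (n : nat) (alpha : R) (gamma : set (R * R)) :=
  exists l (G : R -> R * R),
    [/\ arc_length_param l G gamma,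
        line_class_C n G
      & exists M, forall t s, 0 <= t <= l -> 0 <= s <= l -> t != s ->
          cabs (derive1n n G t - derive1n n G s) / `|t - s| `^ alpha <= M].

Definition Cna_Jordan_domain (n : nat) (alpha : R) (Omega : set (R * R)) :=
  [/\ plane_domain Omega,
      bounded_set Omega
    & Cna_Jordan_curve n alpha (boundary Omega)].

Definition conformal_C1_metric (Omega : set (R * R)) (rho : R * R -> R) :=
  class_C 1 Omega rho /\ forall z, Omega z -> 0 < rho z.

Definition approximately_analytic D (h : R * R -> R * R) :=
  class_C 1 D h /\
  exists2 C : R, 0 <= C &
    forall z, D z -> normc (d_zbar h z) <= C * cabs (h z).

Definition log_density_d_z (rho : R * R -> R) z : R[i] :=
  d_z (real_valued (fun u => ln (rho u))) z.

Definition rho_harmonic (rho : R * R -> R) D (Omega : set (R * R))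
    (f : R * R -> R * R) :=
  [/\ f @` D `<=` Omega,
      class_C 2 D f
    & forall z, D z ->
        d_zbar (fun u => plane_of (d_z f u)) z
        + log_density_d_z rho (f z) * d_z f z * d_zbar f z = 0].

Definition grad_norm (w : R * R -> R * R) z : R :=
  normc (d_z w z) + normc (d_zbar w z).

Definition jacobian (w : R * R -> R * R) z : R :=
  normc (d_z w z) ^+ 2 - normc (d_zbar w z) ^+ 2.

Definition plane_measure :=
  (@lebesgue_measure R \x @lebesgue_measure R)%E.

Definition absolutely_continuous_on (a b : R) (g : R -> R * R) :=
  forall eps : R, 0 < eps -> exists2 delta : R, 0 < delta &
    forall (n : nat) (x y : 'I_n -> R),
      (forall i, [/\ a <= x i, x i <= y i & y i <= b]) ->
      (forall i j, i != j -> y i <= x j \/ y j <= x i) ->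
      \sum_(i < n) (y i - x i) < delta ->
      \sum_(i < n) cabs (g (y i) - g (x i)) < eps.

Definition ACL D (w : R * R -> R * R) :=
  forall a b c d : R, a < b -> c < d ->
    `[a, b]%classic `*` `[c, d]%classic `<=` D ->
    {ae @lebesgue_measure R, forall y : R, c <= y <= d ->
       absolutely_continuous_on a b (fun x => w (x, y))} /\
    {ae @lebesgue_measure R, forall x : R, a <= x <= b ->
       absolutely_continuous_on c d (fun y => w (x, y))}.

Definition locally_L2 D (g : R * R -> R * R) :=
  measurable_fun D g /\
  forall A : set (R * R), compact A -> A `<=` D ->
    (\int[plane_measure]_(z in A) (cabs (g z) ^+ 2)%:E < +oo)%E.

Definition ACL2 D (w : R * R -> R * R) :=
  [/\ ACL D w, locally_L2 D (dx w) & locally_L2 D (dy w)].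

Definition circle (a : R * R) (r : R) (t : R) : R * R :=
  (a.1 + r * cos t, a.2 + r * sin t).

(** The loop [g] on [[0, 2 pi]] avoids [p] and winds [n] times around it;
    [theta] is a continuous branch of the argument of [g - p]. *)
Definition winding_number (g : R -> R * R) (p : R * R) (n : int) :=
  exists theta : R -> R,
    [/\ {within `[0, 2 * pi], continuous theta},
        forall t, 0 <= t <= 2 * pi ->
          g t != p /\
          g t - p = (cabs (g t - p) * cos (theta t),
                     cabs (g t - p) * sin (theta t))
      & theta (2 * pi) - theta 0 = 2 * pi * n%:~R].

(** Positivity of the local topological degree: over every closed disc
    contained in [D], [w] has positive degree at each value that it takes
    inside the disc but not on the bounding circle, the degree there being the
    winding number of the image of the circle. *)
Definition sense_preserving D (w : R * R -> R * R) :=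
  forall (a : R * R) (r : R), 0 < r ->
    [set z | cabs (z - a) <= r] `<=` D ->
    forall p, (w @` [set z | cabs (z - a) < r]) p ->
      ~ (w @` [set z | cabs (z - a) = r]) p ->
      exists2 n : int, 0 < n & winding_number (w \o circle a r) p n.

Definition quasiregular (K K' : R) D (Omega : set (R * R))
    (w : R * R -> R * R) :=
  [/\ w @` D `<=` Omega,
      forall z, D z -> {for z, continuous w},
      sense_preserving D w,
      ACL2 D w
    & {ae plane_measure, forall z, D z -> jacobian w z != 0} /\
      {ae plane_measure, forall z, D z ->
         grad_norm w z ^+ 2 <= K * jacobian w z + K'}].

Definition proper_map D (Omega : set (R * R)) (w : R * R -> R * R) :=
  w @` D `<=` Omega /\
  forall A, compact A -> A `<=` Omega -> compact (D `&` w @^-1` A).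

End Plane.

(* Main.v *)
Require Import Defs.
From mathcomp Require Import all_boot all_order all_algebra.
From mathcomp Require Import complex.
From mathcomp Require Import all_classical all_reals all_analysis.
From mathcomp Require Import ring lra.

Import Order.TTheory GRing.Theory Num.Theory.
Import numFieldNormedType.Exports.

Local Open Scope classical_set_scope.
Local Open Scope ring_scope.

Set Implicit Arguments.
Unset Strict Implicit.
Unset Printing Implicit Defensive.

(** The proof has an analytic and a geometric half, and they meet in the
    distance from [w z] to the boundary curve.

    Write [N = |w_x|^2 + |w_y|^2].  For a real density [rho],
    [|(log rho)_z| = |rho_zbar| / rho] is bounded, so the harmonicity equation
    gives [|Delta w| <= B N].  The quasiregularity inequality, which extends
    from almost every point to every point by continuity, says that no direction
    is much more contracted than the others, up to an additive constant: for
    every unit vector [n], [N <= 4 K^2 |grad (n . w)|^2 + 4 K'].  Hence a single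
    real component, chosen normal to the boundary, satisfies a Poisson inequality
    whose right-hand side is quadratic in its own gradient, and it controls the
    whole gradient of [w].

    The boundary curve is of class [C^2] with unit speed, so it deviates from
    its tangents quadratically and uniformly; this is
    [loop_quadratic_contact].  In terms of nearest points it is the property
    [projects_onto], the only information about the shape of the curve that is
    used afterwards.  It provides a tangent disc of uniform radius towards each point
    off the curve.

    First, the distance from [w z] to the boundary is at most a multiple of
    [1 - |z|^2] ([boundary_decay]).  At a point where the distance minus a
    barrier in [1 - |z|^2] is maximal, the tangent disc gives a smooth function
    of [w] that touches the distance from below; comparing Laplacians contradicts
    the choice of the barrier.  The distance itself is never differentiated.

    Second, at depth [s = 1 - |z|^2] the map is looked at in a square of size
    comparable to [s].  On a smaller square around a point where [sqrt N] at most
    doubles, the component of [w] normal to the curve at the nearest point is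
    [O(s)], by the first step and the quadratic contact.  The linear interior
    gradient estimate for the Poisson equation, with the right-hand side bounded
    by the doubled gradient, then closes up for small [s] and bounds [N]
    ([gradient_bounded_near_boundary]).  Away from the boundary [N] is continuous
    on a compact set.  Lipschitz continuity follows from the mean value theorem
    along axis-parallel paths in the disc.

    Only derivatives along the two axes enter, so that all calculus is done on
    axis-parallel slices. *)

(** * One-variable calculus *)

Section OneVariable.
Context {R : realType}.
Implicit Types (g dg : R -> R) (x c : R).

Lemma is_derive_continuous g x c : is_derive x 1 g c -> {for x, continuous g}.
Proof. by case=> /derivable1_diffP/differentiable_continuous. Qed.

Lemma is_derive_gt0_increase g x c : is_derive x 1 g c -> 0 < c ->
  exists2 e, 0 < e & forall h, 0 < h < e -> g x < g (x + h).
Proof.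
move=> [dg gc] c0.
have : h^-1 *: (g (h *: 1 + x) - g x) @[h --> 0^'] --> c by rewrite -gc.
move/cvgrPdist_lt => /(_ _ c0) [e /= e0 He].
exists e => // h /andP[h0 he].
have := He h; rewrite /= sub0r normrN gtr0_norm// gt_eqF// => /(_ he isT).
rewrite [h *: 1]mulr1 (addrC h) /GRing.scale /= => H.
have : 0 < h^-1 * (g (x + h) - g x).
  move: H; rewrite ltr_norml => /andP[]; lra.
by rewrite pmulr_rgt0 ?invr_gt0// subr_gt0.
Qed.

Lemma MVT_between g dg lo hi x y : lo <= x <= hi -> lo <= y <= hi ->
  (forall t, lo <= t <= hi -> is_derive t 1 g (dg t)) ->
  exists2 c, lo <= c <= hi & g y - g x = dg c * (y - x).
Proof.
wlog xy : x y / x <= y.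
  move=> W hx hy hd; have [xy|yx] := leP x y; first exact: W.
  have [c hc E] := W y x (ltW yx) hy hx hd.
  by exists c => //; rewrite -[LHS]opprB E -mulrN opprB.
move=> /andP[lx xh] /andP[ly yh] hd.
have hd' t : x <= t <= y -> is_derive t 1 g (dg t).
  by move=> /andP[xt ty]; apply: hd; rewrite (le_trans lx)//= (le_trans ty).
have [|t /=|c] := @MVT_segment R g dg x y xy.
- by move=> t; rewrite in_itv/= => /andP[/ltW a /ltW b]; apply: hd'; rewrite a.
- apply: (@continuous_in_subspaceT _ _ _ g) => s; rewrite inE/= in_itv/= => hs.
  exact: is_derive_continuous (hd' _ hs).
- rewrite in_itv/= => /andP[xc cy] E; exists c => //.
  by rewrite (le_trans lx)//= (le_trans cy).
Qed.

Lemma MVT_bound g dg lo hi x y M : lo <= x <= hi -> lo <= y <= hi ->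
  (forall t, lo <= t <= hi -> is_derive t 1 g (dg t)) ->
  (forall t, lo <= t <= hi -> `|dg t| <= M) ->
  `|g y - g x| <= M * `|y - x|.
Proof.
move=> hx hy hd hM; have [c hc ->] := MVT_between hx hy hd.
by rewrite normrM ler_wpM2r// hM.
Qed.

(** If [c] were positive, [dg] would be positive just to the right of its zero
    [x], and [g] would increase there. *)
Lemma local_max_second_derivative g dg x c e : 0 < e ->
  (forall t, `|t - x| < e -> is_derive t 1 g (dg t)) ->
  is_derive x 1 dg c ->
  (forall t, `|t - x| < e -> g t <= g x) -> dg x = 0 /\ c <= 0.
Proof.
move=> e0 hd hc hmax.
have near_x t : t \in `]x - e, x + e[%R -> `|t - x| < e.
  by rewrite in_itv/= ltr_distl => /andP[-> ->].
have dg0 : dg x = 0.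
  have xx : `|x - x| < e by rewrite subrr normr0.
  have [_ <-] := hd _ xx.
  suff [_ ->] : is_derive x 1 g 0 by [].
  apply: (@derive1_at_max R g (x - e) (x + e) x); first lra.
  - by move=> t /near_x ht; have [] := hd _ ht.
  - by rewrite in_itv/=; lra.
  - by move=> t /near_x; exact: hmax.
split=> //; rewrite leNgt; apply/negP => c0.
have [d d0 Hd] := is_derive_gt0_increase hc c0.
pose h := Num.min d e / 2.
have m0 : 0 < Num.min d e by rewrite lt_min d0 e0.
have [hd' he] : h < d /\ h < e.
  have : Num.min d e <= d by rewrite ge_min lexx.
  have : Num.min d e <= e by rewrite ge_min lexx orbT.
  by rewrite /h; lra.
have h0 : 0 < h by rewrite /h; lra.
have dgE t : x <= t <= x + h -> is_derive t 1 g (dg t).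
  by move=> ht; apply: hd; rewrite ltr_distl; lra.
have [|t|r|s] := @MVT R g dg x (x + h); first lra.
- by rewrite in_itv/= => ht; apply: dgE; lra.
- apply: (@continuous_in_subspaceT _ _ _ g) => q; rewrite inE/= in_itv/= => hq.
  exact: is_derive_continuous (dgE _ hq).
- rewrite in_itv/= => hs E.
  have := Hd (s - x); rewrite dg0 (addrC x) subrK => /(_ ltac:(lra)) ds.
  have : g (x + h) <= g x by apply: hmax; rewrite (addrC x) addrK gtr0_norm.
  rewrite -subr_le0 E (addrC x) addrK leNgt => /negP; apply.
  exact: mulr_gt0.
Qed.

End OneVariable.

Section Directional.
Context {R : realType}.

(** The difference quotients on both sides agree.  Slices of a function along
    the axes, swaps of the coordinates and straight lines are all of this form. *)
Lemma is_derive_affine (U V W : normedModType R) (A : U -> V) (u : V -> W)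
    z v v' l : (forall h : R, A (h *: v + z) = h *: v' + A z) ->
  is_derive (A z) v' u l -> is_derive z v (u \o A) l.
Proof.
move=> hA [du ul].
have E : (fun h => h^-1 *: (((u \o A) \o shift z) (h *: v) - (u \o A) z))
       = (fun h => h^-1 *: ((u \o shift (A z)) (h *: v') - u (A z))).
  by apply/funext => h /=; rewrite hA.
by split; [rewrite /derivable E|rewrite /derive E].
Qed.

Lemma is_derive_oppdir (V W : normedModType R) (u : V -> W) z v l :
  is_derive z v u l -> is_derive z (- v) u (- l).
Proof.
move=> [du ul].
have hc : h^-1 *: (u (h *: v + z) - u z) @[h --> 0^'] --> l by rewrite -ul.
have hN : (- h : R) @[h --> 0^'] --> (0 : R)^'.
  move=> S [e /= e0 He]; exists e => //= h; rewrite /= sub0r normrN => he h0.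
  by apply: He; rewrite /= ?oppr_eq0// sub0r opprK.
have hl : h^-1 *: (u (h *: - v + z) - u z) @[h --> 0^'] --> - l.
  rewrite (_ : (fun h => _) = (fun h : R =>
     - ((- h)^-1 *: (u (- h *: v + z) - u z)))); last first.
    by apply/funext => h; rewrite invrN scaleNr opprK scalerN scaleNr.
  by apply: cvgN; apply: (cvg_comp _ _ hN hc).
by split; [apply/cvg_ex; exists (- l)|exact: cvg_lim hl].
Qed.

End Directional.

(** * Maximum principle in the plane *)

Section TwoVariables.
Context {R : realType}.
Implicit Types (z : R * R) (D : set (R * R)).

Definition ex : R * R := (1, 0).
Definition ey : R * R := (0, 1).

(** The partial derivatives are carried as explicit functions, so that those
    of sums, products and compositions come as formulas and Laplacians can be
    compared by ring identities. *)
Definition C2_on D (u ux uy uxx uyy : R * R -> R) := forall z, D z ->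
  [/\ {for z, continuous u}, is_derive z ex u (ux z), is_derive z ey u (uy z),
      is_derive z ex ux (uxx z) & is_derive z ey uy (uyy z)].

Definition box z (l : R) : set (R * R) :=
  [set z' | `|z'.1 - z.1| <= l /\ `|z'.2 - z.2| <= l].

Lemma pair_scaleD (h : R) (v z : R * R) :
  h *: v + z = (h * v.1 + z.1, h * v.2 + z.2).
Proof. by case: v; case: z. Qed.

Lemma is_derive_slice_x (u : R * R -> R) x y l :
  is_derive (x, y) ex u l -> is_derive x 1 (fun t => u (t, y)) l.
Proof.
apply: (@is_derive_affine R R (R * R)%type R (fun t => (t, y))) => h.
by rewrite !pair_scaleD/= mulr0 add0r.
Qed.

Lemma is_derive_slice_y (u : R * R -> R) x y l :
  is_derive (x, y) ey u l -> is_derive y 1 (fun t => u (x, t)) l.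
Proof.
apply: (@is_derive_affine R R (R * R)%type R (fun t => (x, t))) => h.
by rewrite !pair_scaleD/= mulr0 add0r.
Qed.

Lemma local_max_laplacian D (u ux uy uxx uyy : R * R -> R) z e : 0 < e ->
  C2_on D u ux uy uxx uyy ->
  (forall z', `|z'.1 - z.1| < e -> `|z'.2 - z.2| < e -> D z' /\ u z' <= u z) ->
  [/\ ux z = 0, uy z = 0 & uxx z + uyy z <= 0].
Proof.
case: z => x y /= e0 Du umax.
have x0 : `|x - x| < e by rewrite subrr normr0.
have y0 : `|y - y| < e by rewrite subrr normr0.
have hx t : `|t - x| < e -> D (t, y) /\ u (t, y) <= u (x, y).
  by move=> ht; apply: umax.
have hy t : `|t - y| < e -> D (x, t) /\ u (x, t) <= u (x, y).
  by move=> ht; apply: umax.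
have [||t /hx[]//|-> ux0] := @local_max_second_derivative R (fun t => u (t, y))
    (fun t => ux (t, y)) x (uxx (x, y)) e e0.
- by move=> t /hx[Dt _]; apply: is_derive_slice_x; case: (Du _ Dt).
- by apply: is_derive_slice_x; have [Dt _] := hx _ x0; case: (Du _ Dt).
have [||t /hy[]//|-> uy0] := @local_max_second_derivative R (fun t => u (x, t))
    (fun t => uy (x, t)) y (uyy (x, y)) e e0.
- by move=> t /hy[Dt _]; apply: is_derive_slice_y; case: (Du _ Dt).
- by apply: is_derive_slice_y; have [Dt _] := hy _ y0; case: (Du _ Dt).
by split=> //; lra.
Qed.

Lemma C2_onD D u ux uy uxx uyy v vx vy vxx vyy :
  C2_on D u ux uy uxx uyy -> C2_on D v vx vy vxx vyy ->
  C2_on D (fun z => u z + v z) (fun z => ux z + vx z) (fun z => uy z + vy z)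
    (fun z => uxx z + vxx z) (fun z => uyy z + vyy z).
Proof.
move=> Du Dv z Dz; have [cu ? ? ? ?] := Du z Dz; have [cv ? ? ? ?] := Dv z Dz.
by split; [exact: continuousD|exact: is_deriveD..].
Qed.

Lemma C2_onM D u ux uy uxx uyy v vx vy vxx vyy :
  C2_on D u ux uy uxx uyy -> C2_on D v vx vy vxx vyy ->
  C2_on D (fun z => u z * v z)
    (fun z => u z * vx z + v z * ux z) (fun z => u z * vy z + v z * uy z)
    (fun z => (u z * vxx z + vx z * ux z) + (v z * uxx z + ux z * vx z))
    (fun z => (u z * vyy z + vy z * uy z) + (v z * uyy z + uy z * vy z)).
Proof.
move=> Du Dv z Dz; have [cu ? ? ? ?] := Du z Dz; have [cv ? ? ? ?] := Dv z Dz.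
split; first exact: continuousM.
- exact: is_deriveM.
- exact: is_deriveM.
- by apply: is_deriveD; exact: is_deriveM.
- by apply: is_deriveD; exact: is_deriveM.
Qed.

Lemma C2_on_cst D (c : R) :
  C2_on D (fun=> c) (fun=> 0) (fun=> 0) (fun=> 0) (fun=> 0).
Proof.
by move=> z _; split; [exact: cst_continuous|exact: is_derive_cst..].
Qed.

Lemma is_derive_fst z v : is_derive z v (fst : R * R -> R) v.1.
Proof.
apply: (@is_derive_affine R (R * R)%type R R fst id z v v.1).
by move=> h; rewrite pair_scaleD.
Qed.

Lemma is_derive_snd z v : is_derive z v (snd : R * R -> R) v.2.
Proof.
apply: (@is_derive_affine R (R * R)%type R R snd id z v v.2).
by move=> h; rewrite pair_scaleD.
Qed.

Lemma C2_on_fst D : C2_on D fst (fun=> 1) (fun=> 0) (fun=> 0) (fun=> 0).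
Proof.
move=> z _; split; [exact: cvg_fst|exact: is_derive_fst..| |];
  exact: is_derive_cst.
Qed.

Lemma C2_on_snd D : C2_on D snd (fun=> 0) (fun=> 1) (fun=> 0) (fun=> 0).
Proof.
move=> z _; split; [exact: cvg_snd|exact: is_derive_snd..| |];
  exact: is_derive_cst.
Qed.

Lemma C2_onZ D (c : R) u ux uy uxx uyy : C2_on D u ux uy uxx uyy ->
  C2_on D (fun z => c * u z) (fun z => c * ux z) (fun z => c * uy z)
    (fun z => c * uxx z) (fun z => c * uyy z).
Proof.
move=> Du z Dz; have [cu ? ? ? ?] := Du z Dz.
split; first by apply: continuousM => //; exact: cst_continuous.
all: exact: is_deriveZ.
Qed.

Lemma C2_on_sub D E u ux uy uxx uyy : E `<=` D -> C2_on D u ux uy uxx uyy ->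
  C2_on E u ux uy uxx uyy.
Proof. by move=> ED Du z /ED; exact: Du. Qed.

Definition swap z : R * R := (z.2, z.1).
(** The reflection in the horizontal line at height [c / 2]. *)
Definition reflect_y (c : R) z : R * R := (z.1, c - z.2).

Lemma continuous_pair (T : topologicalType) (f g : T -> R) t :
  {for t, continuous f} -> {for t, continuous g} ->
  {for t, continuous (fun x => (f x, g x))}.
Proof.
by move=> cf cg; apply: (@cvg_pair _ _ _ _ (nbhs (f t)) (nbhs (g t))).
Qed.

Lemma swap_continuous : continuous swap.
Proof.
by move=> z; apply: continuous_pair; [exact: cvg_snd|exact: cvg_fst].
Qed.

Lemma reflect_y_continuous c : continuous (reflect_y c).
Proof.
move=> z; apply: continuous_pair; first exact: cvg_fst.
by apply: cvgB; [exact: cvg_cst|exact: cvg_snd].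
Qed.

Lemma C2_on_swap D u ux uy uxx uyy : C2_on D u ux uy uxx uyy ->
  C2_on (swap @^-1` D) (u \o swap) (uy \o swap) (ux \o swap)
    (uyy \o swap) (uxx \o swap).
Proof.
move=> Du z Dz; have [cu hx hy hxx hyy] := Du _ Dz.
have sx (h : R) : swap (h *: ex + z) = h *: ey + swap z.
  by rewrite !pair_scaleD.
have sy (h : R) : swap (h *: ey + z) = h *: ex + swap z.
  by rewrite !pair_scaleD.
split; first by apply: continuous_comp => //; exact: swap_continuous.
- exact: (is_derive_affine sx hy).
- exact: (is_derive_affine sy hx).
- exact: (is_derive_affine sx hyy).
- exact: (is_derive_affine sy hxx).
Qed.

Lemma C2_on_reflect c D u ux uy uxx uyy : C2_on D u ux uy uxx uyy ->
  C2_on (reflect_y c @^-1` D) (u \o reflect_y c) (ux \o reflect_y c)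
    (fun z => - uy (reflect_y c z)) (uxx \o reflect_y c) (uyy \o reflect_y c).
Proof.
move=> Du z Dz; have [cu hx hy hxx hyy] := Du _ Dz.
have sx (h : R) : reflect_y c (h *: ex + z) = h *: ex + reflect_y c z.
  by rewrite !pair_scaleD /reflect_y/=; congr pair; ring.
have sy (h : R) : reflect_y c (h *: ey + z) = h *: (- ey) + reflect_y c z.
  by rewrite !pair_scaleD /reflect_y/=; congr pair; ring.
split; first by apply: continuous_comp => //; exact: reflect_y_continuous.
- exact: (is_derive_affine sx hx).
- exact: (is_derive_affine sy (is_derive_oppdir hy)).
- exact: (is_derive_affine sx hxx).
- have /is_deriveN := is_derive_affine sy (is_derive_oppdir hyy).
  by rewrite opprK.
Qed.

End TwoVariables.

(** * Interior gradient estimate for the Poisson equation *)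

Section PoissonGradient.
Context {R : realType}.
Implicit Types (z : R * R) (D : set (R * R)).

Lemma C2_on_eq D (u ux uy uxx uyy v vx vy vxx vyy : R * R -> R) :
  u =1 v -> ux =1 vx -> uy =1 vy -> uxx =1 vxx -> uyy =1 vyy ->
  C2_on D u ux uy uxx uyy -> C2_on D v vx vy vxx vyy.
Proof. by do 5 move=> /funext ->. Qed.

Lemma C2_on_shift D (p q : R) :
  C2_on D (fun z => z.1 - p) (fun=> 1) (fun=> 0) (fun=> 0) (fun=> 0) /\
  C2_on D (fun z => z.2 - q) (fun=> 0) (fun=> 1) (fun=> 0) (fun=> 0).
Proof.
split.
- have := C2_onD (C2_on_fst (D := D)) (C2_on_cst (D := D) (- p)).
  by apply: C2_on_eq => z /=; rewrite ?addr0.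
- have := C2_onD (C2_on_snd (D := D)) (C2_on_cst (D := D) (- q)).
  by apply: C2_on_eq => z /=; rewrite ?addr0.
Qed.

Lemma C2_on_quadratic D (a b c p q : R) :
  C2_on D (fun z => a * (z.1 - p) ^+ 2 + b * (z.2 - q) ^+ 2 + c * (z.2 - q))
    (fun z => 2 * a * (z.1 - p)) (fun z => 2 * b * (z.2 - q) + c)
    (fun=> 2 * a) (fun=> 2 * b).
Proof.
have [X Y] := C2_on_shift D p q.
have := C2_onD (C2_onD (C2_onZ a (C2_onM X X)) (C2_onZ b (C2_onM Y Y)))
  (C2_onZ c Y).
by apply: C2_on_eq => z /=; ring.
Qed.

Lemma C2_on_within_continuous D (u ux uy uxx uyy : R * R -> R) :
  C2_on D u ux uy uxx uyy -> {within D, continuous u}.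
Proof.
by move=> Du; apply: continuous_in_subspaceT => z; rewrite inE => /Du[].
Qed.

(** The odd part of [u] under the reflection in the horizontal line through [z]
    vanishes on that line.  On the upper half of the square it lies below the
    quadratic barrier with data [S] and [F] that vanishes at [z], by the maximum
    principle, so its slope at [z] is at most that of the barrier. *)
Lemma poisson_gradient_upper (u ux uy uxx uyy : R * R -> R) z (l S F : R) :
  0 < l ->
  C2_on (box z l) u ux uy uxx uyy ->
  (forall z', box z l z' -> `|u z'| <= S) ->
  (forall z', box z l z' -> `|uxx z' + uyy z'| < F) ->
  uy z <= 2 * S / l + F * l / 2.
Proof.
case: z => x0 y0 l0 Du uS uF.
have bz : box (x0, y0) l (x0, y0) by split; rewrite /= subrr normr0 ltW.
have S0 : 0 <= S by apply: le_trans (uS _ bz).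
have F0 : 0 < F by apply: le_lt_trans (uF _ bz).
pose s := S / l ^+ 2.
have sl : S = s * l ^+ 2 by rewrite /s divfK// expf_neq0// gt_eqF.
have s0 : 0 <= s by rewrite /s divr_ge0// exprn_ge0// ltW.
have -> : 2 * S / l + F * l / 2 = 2 * s * l + F * l / 2.
  by rewrite sl; congr (_ + _); field; rewrite gt_eqF.
have DuR := C2_on_reflect (c := 2 * y0) Du.
set B := box (x0, y0) l in Du DuR uS uF *.
have BR z' : B z' -> B (reflect_y (2 * y0) z').
  rewrite /B /box/= => -[h1 h2]; split=> //.
  by rewrite -normrN; apply: le_trans h2; rewrite le_eqVlt; apply/orP; left;
    apply/eqP; congr `|_|; ring.
have DuR' : B `<=` reflect_y (2 * y0) @^-1` B by move=> z' /BR.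
(* the odd part minus the barrier
   [S / l^2 (x^2 + y (2 l - y)) + F / 2 y (l - y)], centred at [z] *)
have := C2_onD (C2_onD (C2_onZ 2^-1 Du)
  (C2_onZ (- 2^-1) (C2_on_sub DuR' DuR)))
  (C2_on_quadratic (D := B) (- s) (s + F / 2) (- (2 * s * l + F * l / 2))
     x0 y0).
set G := fun z => _; set Gx := fun z => _; set Gy := fun z => _.
set Gxx := fun z => _; set Gyy := fun z => _ => DG.
pose K : set (R * R) := `[x0 - l, x0 + l] `*` `[y0, y0 + l].
have KB : K `<=` B.
  move=> [x y]; rewrite /K /B /box/= !in_itv/= => -[h1 h2].
  by split; rewrite ler_distl; lra.
have K0 : K !=set0 by exists (x0, y0); rewrite /K/= !in_itv/=; split; lra.
have cK : compact K by apply: compact_setX; exact: segment_compact.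
have cG : {within K, continuous G}.
  exact: C2_on_within_continuous (C2_on_sub KB DG).
(* a positive maximum can only be attained inside the half-square *)
have [[xm ym] Kc cmax] := compact_EVT_max K0 cK cG.
have Gle : forall z', K z' -> G z' <= 0.
  move=> z' Kz'; apply: (le_trans (cmax z' _)); first by rewrite inE.
  rewrite leNgt; apply/negP => Gpos.
  move: Kc; rewrite inE => Kc; have Bc := KB _ Kc.
  have [u1 u2] := (uS _ Bc, uS _ (BR _ Bc)).
  move: (Kc); rewrite /K/= !in_itv/= => -[hx hy].
  move: u1 u2; rewrite !ler_norml /reflect_y/= => u1 u2.
  have Gc : G (xm, ym) = 2^-1 * u (xm, ym) + - 2^-1 * u (xm, 2 * y0 - ym)
     + (- s * (xm - x0) ^+ 2 + (s + F / 2) * (ym - y0) ^+ 2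
        + - (2 * s * l + F * l / 2) * (ym - y0)) by [].
  have sx : 0 <= s * (xm - x0) ^+ 2 by rewrite mulr_ge0// sqr_ge0.
  have y1 : ym != y0.
    apply/eqP => E; move: Gpos; rewrite Gc E.
    have -> : 2 * y0 - y0 = y0 by ring.
    by move: sx; lra.
  have y2 : ym != y0 + l.
    apply/eqP => E; move: Gpos; rewrite Gc E.
    by move: sx u1 u2; rewrite sl E; lra.
  have tx (t : R) : t ^+ 2 = l ^+ 2 -> t = xm - x0 -> False.
    move=> tl E; move: Gpos; rewrite Gc -E tl.
    have : 0 <= s * ((ym - y0) * (2 * l - (ym - y0))).
      by apply: mulr_ge0 => //; apply: mulr_ge0; lra.
    have : 0 <= F * ((ym - y0) * (l - (ym - y0))).
      by apply: mulr_ge0; [exact: ltW|apply: mulr_ge0; lra].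
    by move: u1 u2; rewrite sl; lra.
  have x1 : xm != x0 - l by apply/eqP => E; apply: (tx (- l)); [ring|lra].
  have x2 : xm != x0 + l by apply/eqP => E; apply: (tx l); [ring|lra].
  have hx' : x0 - l < xm < x0 + l.
    by rewrite lt_def x1 lt_def eq_sym x2; lra.
  have hy' : y0 < ym < y0 + l by rewrite lt_def y1 lt_def eq_sym y2; lra.
  pose e := Num.min (Num.min (xm - (x0 - l)) (x0 + l - xm))
                    (Num.min (ym - y0) (y0 + l - ym)).
  have e0 : 0 < e by rewrite /e !lt_min; lra.
  have ele : [/\ e <= xm - (x0 - l), e <= x0 + l - xm, e <= ym - y0
               & e <= y0 + l - ym].
    by split; rewrite /e !ge_min lexx ?orbT.
  have Gmax z'' : `|z''.1 - xm| < e -> `|z''.2 - ym| < e ->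
      B z'' /\ G z'' <= G (xm, ym).
    case: z'' => x' y' /=; rewrite !ltr_distl => h1 h2.
    have Kxy : K (x', y') by case: ele; rewrite /K/= !in_itv/=; split; lra.
    by split; [exact: KB|apply: cmax; rewrite inE].
  have [_ _] := local_max_laplacian (z := (xm, ym)) e0 DG Gmax.
  have := uF _ Bc; have := uF _ (BR _ Bc); rewrite !ltr_norml /Gxx /Gyy/=.
  by lra.
have bR : reflect_y (2 * y0) (x0, y0) = (x0, y0).
  by rewrite /reflect_y/=; congr pair; ring.
have G0 : G (x0, y0) = 0 by rewrite /G /= bR !subrr; ring.
have GyE : Gy (x0, y0) = uy (x0, y0) - (2 * s * l + F * l / 2).
  by rewrite /Gy/= bR subrr; field.
rewrite -subr_le0 -GyE leNgt; apply/negP => pos.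
have [_ _ /is_derive_slice_y dG _ _] := DG _ bz.
have [e e0 He] := is_derive_gt0_increase dG pos.
have h0 : 0 < Num.min e l by rewrite lt_min e0.
have he : Num.min e l <= e by rewrite ge_min lexx.
have hl : Num.min e l <= l by rewrite ge_min lexx orbT.
have := He (Num.min e l / 2) ltac:(lra).
rewrite G0 ltNge => /negP; apply; apply: Gle.
by rewrite /K/= !in_itv/=; split; lra.
Qed.

Lemma poisson_gradient_y (u ux uy uxx uyy : R * R -> R) (z : R * R)
    (l S F : R) : 0 < l ->
  C2_on (box z l) u ux uy uxx uyy ->
  (forall z', box z l z' -> `|u z'| <= S) ->
  (forall z', box z l z' -> `|uxx z' + uyy z'| < F) ->
  `|uy z| <= 2 * S / l + F * l / 2.
Proof.
move=> l0 Du uS uF; rewrite ler_norml; apply/andP; split; last first.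
  exact: poisson_gradient_upper Du uS uF.
have := @poisson_gradient_upper _ _ _ _ _ z l S F l0 (C2_onZ (-1) Du).
rewrite mulN1r lerNl; apply.
- by move=> z' /uS; rewrite mulN1r normrN.
- by move=> z' /uF; rewrite !mulN1r -opprD normrN.
Qed.

Lemma poisson_gradient_x (u ux uy uxx uyy : R * R -> R) (z : R * R)
    (l S F : R) : 0 < l ->
  C2_on (box z l) u ux uy uxx uyy ->
  (forall z', box z l z' -> `|u z'| <= S) ->
  (forall z', box z l z' -> `|uxx z' + uyy z'| < F) ->
  `|ux z| <= 2 * S / l + F * l / 2.
Proof.
move=> l0 Du uS uF.
have bs z' : box (swap z) l z' -> box z l (swap z') by case.
have szz : swap (swap z) = z by case: (z).
rewrite -szz.
apply: (@poisson_gradient_y _ _ _ _ _ (swap z) l S F l0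
  (C2_on_sub bs (C2_on_swap Du))) => z' /bs.
- exact: uS.
- by rewrite /= addrC; exact: uF.
Qed.

End PoissonGradient.

(** * Equality of mixed partials *)

Section Clairaut.
Context {R : realType}.

Lemma near_box (P : set (R * R)) (z : R * R) : nbhs z P ->
  exists2 e : R, 0 < e & box z e `<=` P.
Proof.
case/nbhs_ballP => e /= e0 He; exists (e / 2); first by rewrite divr_gt0.
have h : e / 2 < e by rewrite ltr_pdivrMr// ltr_pMr// ltr1n.
case: z He => x y He [a b] [/= h1 h2]; apply: He.
by split; rewrite /ball/= distrC; apply: le_lt_trans h.
Qed.

(** Both mixed partials are values, at points arbitrarily close to [z], of one
    and the same second difference quotient of [f]. *)
Lemma mixed_partials (f fx fy fxy fyx : R * R -> R) (z : R * R) (e : R) :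
  0 < e ->
  (forall z', box z e z' -> [/\ is_derive z' ex f (fx z'),
     is_derive z' ey f (fy z'), is_derive z' ey fx (fxy z') &
     is_derive z' ex fy (fyx z')]) ->
  {for z, continuous fxy} -> {for z, continuous fyx} -> fxy z = fyx z.
Proof.
case: z => x y e0 Df cxy cyx.
apply: contrapT => /eqP ne.
have d0 : 0 < `|fxy (x, y) - fyx (x, y)| / 2.
  by rewrite divr_gt0// normr_gt0 subr_eq0.
have [e1 e10 H1] := near_box ((cvgrPdist_lt _ _).1 cxy _ d0).
have [e2 e20 H2] := near_box ((cvgrPdist_lt _ _).1 cyx _ d0).
(* the side of the square used for the second difference *)
pose h := Num.min e (Num.min e1 e2).
have h0 : 0 < h by rewrite /h !lt_min e0 e10.
have [he h1 h2] : [/\ h <= e, h <= e1 & h <= e2].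
  by split; rewrite /h !ge_min lexx ?orbT.
have bx (s t k : R) : x <= s <= x + h -> y <= t <= y + h -> h <= k ->
    box (x, y) k (s, t).
  by move=> hs ht hk; split; rewrite /= ler_distl; lra.
have xx : x <= x <= x + h by lra.
have xh : x <= x + h <= x + h by lra.
have yy : y <= y <= y + h by lra.
have yh : y <= y + h <= y + h by lra.
(* horizontally, then vertically *)
have [a ha Ea] := @MVT_between R (fun t => f (t, y + h) - f (t, y))
   (fun t => fx (t, y + h) - fx (t, y)) x (x + h) x (x + h) xx xh
   (fun t ht => is_deriveB
      (is_derive_slice_x (let: And4 d _ _ _ := Df _ (bx _ _ _ ht yh he) in d))
      (is_derive_slice_x (let: And4 d _ _ _ := Df _ (bx _ _ _ ht yy he) in d))).
have [b hb Eb] := @MVT_between R (fun t => fx (a, t)) (fun t => fxy (a, t))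
   y (y + h) y (y + h) yy yh
   (fun t ht =>
      is_derive_slice_y (let: And4 _ _ d _ := Df _ (bx _ _ _ ha ht he) in d)).
(* vertically, then horizontally *)
have [b' hb' Eb'] := @MVT_between R (fun t => f (x + h, t) - f (x, t))
   (fun t => fy (x + h, t) - fy (x, t)) y (y + h) y (y + h) yy yh
   (fun t ht => is_deriveB
      (is_derive_slice_y (let: And4 _ d _ _ := Df _ (bx _ _ _ xh ht he) in d))
      (is_derive_slice_y (let: And4 _ d _ _ := Df _ (bx _ _ _ xx ht he) in d))).
have [a' ha' Ea'] := @MVT_between R (fun t => fy (t, b')) (fun t => fyx (t, b'))
   x (x + h) x (x + h) xx xh
   (fun t ht =>
      is_derive_slice_x (let: And4 _ _ _ d := Df _ (bx _ _ _ ht hb' he) in d)).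
have E : fxy (a, b) = fyx (a', b').
  have hh : h * h != 0 by rewrite mulf_neq0 ?gt_eqF.
  have hy : y + h - y = h by ring.
  have hx : x + h - x = h by ring.
  rewrite Eb hx hy in Ea; rewrite Ea' hx hy in Eb'.
  by apply: (mulIf hh); rewrite !mulrA -Ea -Eb'; ring.
have := H1 _ (bx a b e1 ha hb h1); have := H2 _ (bx a' b' e2 ha' hb' h2).
rewrite /= E => k2 k1.
have := ler_distD (fyx (a', b')) (fxy (x, y)) (fyx (x, y)).
by move: k1 k2; rewrite [`|fyx (x, y) - _|]distrC; lra.
Qed.

End Clairaut.

(** * Wirtinger derivatives in real coordinates *)

Section Components.
Context {R : realType}.
Implicit Types (z : R * R) (D : set (R * R)).

Lemma complex_half (a b : R) :
  Complex a b / 2%:R = Complex (a / 2) (b / 2).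
Proof.
apply: (canLR (mulfK _)); first by rewrite pnatr_eq0.
by rewrite mulr_natr mulr2n; apply/eqP; rewrite eq_complex/=; apply/andP; split;
  apply/eqP; field.
Qed.

Lemma imaginaryE : (Num.imaginary : R[i]%C) = Complex 0 1.
Proof. by []. Qed.

Lemma complex_mulI (a b : R) : Complex 0 1 * Complex a b = Complex (- b) a.
Proof. by simpc. Qed.

Lemma d_zE (f : R * R -> R * R) z : d_z f z =
  Complex (((dx f z).1 + (dy f z).2) / 2) (((dx f z).2 - (dy f z).1) / 2).
Proof.
rewrite /d_z /cplx imaginaryE complex_mulI -complex_half; congr (_ / _).
by rewrite -[LHS]/(Complex _ _) opprK.
Qed.

Lemma d_zbarE (f : R * R -> R * R) z : d_zbar f z =
  Complex (((dx f z).1 - (dy f z).2) / 2) (((dx f z).2 + (dy f z).1) / 2).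
Proof. by rewrite /d_zbar /cplx imaginaryE complex_mulI -complex_half. Qed.

Lemma normc_sqr (a b : R) :
  complex.ComplexField.Normc.normc (Complex a b) ^+ 2 = a ^+ 2 + b ^+ 2.
Proof. by rewrite /= sqr_sqrtr// addr_ge0// sqr_ge0. Qed.

Lemma normc_ge0 (c : R[i]%C) : 0 <= complex.ComplexField.Normc.normc c.
Proof. by case: c => a b; exact: sqrtr_ge0. Qed.

Lemma is_derive_proj1 (V : normedModType R) (f : V -> R * R)
    (x v : V) l :
  is_derive x v f l -> is_derive x v (fun y => (f y).1) l.1.
Proof.
move=> [df fl].
have hc : h^-1 *: (f (h *: v + x) - f x) @[h --> 0^'] --> l by rewrite -fl.
have hl : h^-1 *: ((f (h *: v + x)).1 - (f x).1) @[h --> 0^'] --> l.1.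
  by apply: (cvg_comp _ (fst : R * R -> R) hc); exact: cvg_fst.
by split; [apply/cvg_ex; exists l.1|exact: cvg_lim hl].
Qed.

Lemma is_derive_proj2 (V : normedModType R) (f : V -> R * R)
    (x v : V) l :
  is_derive x v f l -> is_derive x v (fun y => (f y).2) l.2.
Proof.
move=> [df fl].
have hc : h^-1 *: (f (h *: v + x) - f x) @[h --> 0^'] --> l by rewrite -fl.
have hl : h^-1 *: ((f (h *: v + x)).2 - (f x).2) @[h --> 0^'] --> l.2.
  by apply: (cvg_comp _ (snd : R * R -> R) hc); exact: cvg_snd.
by split; [apply/cvg_ex; exists l.2|exact: cvg_lim hl].
Qed.

Lemma continuous_proj1 (T : topologicalType) (f : T -> R * R) (x : T) :
  {for x, continuous f} -> {for x, continuous (fun y => (f y).1)}.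
Proof.
by move=> cf; apply: (cvg_comp _ (fst : R * R -> R) cf); exact: cvg_fst.
Qed.

Lemma continuous_proj2 (T : topologicalType) (f : T -> R * R) (x : T) :
  {for x, continuous f} -> {for x, continuous (fun y => (f y).2)}.
Proof.
by move=> cf; apply: (cvg_comp _ (snd : R * R -> R) cf); exact: cvg_snd.
Qed.

Lemma class_C1E (V : normedModType R) D (f : R * R -> V) : class_C 1 D f ->
  forall z, D z ->
  [/\ {for z, continuous f}, is_derive z ex f (dx f z),
      is_derive z ey f (dy f z), {for z, continuous (dx f)} &
      {for z, continuous (dy f)}].
Proof.
move=> [cf [df [cx _] [cy _]]] z Dz; have [d1 d2] := df z Dz.
by split; [exact: cf|exact: derivableP|exact: derivableP|exact: cx|exact: cy].
Qed.

Lemma class_C2_C1 (V : normedModType R) D (f : R * R -> V) :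
  class_C 2 D f -> [/\ class_C 1 D f, class_C 1 D (dx f) & class_C 1 D (dy f)].
Proof.
move=> [cf [df Cx Cy]].
exact: (And3 (conj cf (And3 df (conj Cx.1 I) (conj Cy.1 I))) Cx Cy).
Qed.

Lemma class_C2_components D (f : R * R -> R * R) : class_C 2 D f ->
  C2_on D (fun z => (f z).1) (fun z => (dx f z).1) (fun z => (dy f z).1)
    (fun z => (dx (dx f) z).1) (fun z => (dy (dy f) z).1) /\
  C2_on D (fun z => (f z).2) (fun z => (dx f z).2) (fun z => (dy f z).2)
    (fun z => (dx (dx f) z).2) (fun z => (dy (dy f) z).2).
Proof.
move=> /class_C2_C1[/class_C1E C /class_C1E Cx /class_C1E Cy].
split=> z Dz; have [c fx fy _ _] := C z Dz; have [_ fxx _ _ _] := Cx z Dz;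
  have [_ _ fyy _ _] := Cy z Dz.
- exact: (And5 (continuous_proj1 c) (is_derive_proj1 fx) (is_derive_proj1 fy)
    (is_derive_proj1 fxx) (is_derive_proj1 fyy)).
- exact: (And5 (continuous_proj2 c) (is_derive_proj2 fx) (is_derive_proj2 fy)
    (is_derive_proj2 fxx) (is_derive_proj2 fyy)).
Qed.

Lemma class_C2_mixed D (f : R * R -> R * R) z : open D -> class_C 2 D f ->
  D z -> dy (dx f) z = dx (dy f) z.
Proof.
move=> oD /class_C2_C1[/class_C1E C /class_C1E Cx /class_C1E Cy] Dz.
have [e e0 He] := near_box (open_nbhs_nbhs (conj oD Dz)).
have [_ _ _ _ cxy] := Cx z Dz; have [_ _ _ cyx _] := Cy z Dz.
have [] : (dy (dx f) z).1 = (dx (dy f) z).1 /\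
           (dy (dx f) z).2 = (dx (dy f) z).2; last first.
  by case: (dy (dx f) z) (dx (dy f) z) => a b [c d] /= -> ->.
split.
- apply: (@mixed_partials R (fun z => (f z).1) (fun z => (dx f z).1)
    (fun z => (dy f z).1) (fun z => (dy (dx f) z).1) (fun z => (dx (dy f) z).1)
    z e e0 _ (continuous_proj1 cxy) (continuous_proj1 cyx)) => z' /He Dz'.
  have [_ fx fy _ _] := C z' Dz'; have [_ _ fxy _ _] := Cx z' Dz'.
  have [_ fyx _ _ _] := Cy z' Dz'.
  exact: (And4 (is_derive_proj1 fx) (is_derive_proj1 fy) (is_derive_proj1 fxy)
    (is_derive_proj1 fyx)).
- apply: (@mixed_partials R (fun z => (f z).2) (fun z => (dx f z).2)
    (fun z => (dy f z).2) (fun z => (dy (dx f) z).2) (fun z => (dx (dy f) z).2)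
    z e e0 _ (continuous_proj2 cxy) (continuous_proj2 cyx)) => z' /He Dz'.
  have [_ fx fy _ _] := C z' Dz'; have [_ _ fxy _ _] := Cx z' Dz'.
  have [_ fyx _ _ _] := Cy z' Dz'.
  exact: (And4 (is_derive_proj2 fx) (is_derive_proj2 fy) (is_derive_proj2 fxy)
    (is_derive_proj2 fyx)).
Qed.

End Components.

(** * Pointwise consequences of quasiregularity *)

Section PointwiseData.
Context {R : realType}.
Implicit Types (z : R * R) (D : set (R * R)).

(** The squared Hilbert-Schmidt norm of the Jacobian matrix, that is
    [2 (|w_z|^2 + |w_zbar|^2)].  Unlike the operator norm it is polynomial in the
    partial derivatives. *)
Definition gradsq (w : R * R -> R * R) z : R :=
  (dx w z).1 ^+ 2 + (dx w z).2 ^+ 2 + (dy w z).1 ^+ 2 + (dy w z).2 ^+ 2.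

Lemma gradsq_ge0 (w : R * R -> R * R) z : 0 <= gradsq w z.
Proof. by rewrite /gradsq !addr_ge0// sqr_ge0. Qed.

Lemma normc_d_z_sqr (w : R * R -> R * R) z :
  complex.ComplexField.Normc.normc (d_z w z) ^+ 2 =
  (((dx w z).1 + (dy w z).2) ^+ 2 + ((dx w z).2 - (dy w z).1) ^+ 2) / 4.
Proof.
by rewrite d_zE normc_sqr; case: (dx w z) (dy w z) => a b [c d] /=; field.
Qed.

Lemma normc_d_zbar_sqr (w : R * R -> R * R) z :
  complex.ComplexField.Normc.normc (d_zbar w z) ^+ 2 =
  (((dx w z).1 - (dy w z).2) ^+ 2 + ((dx w z).2 + (dy w z).1) ^+ 2) / 4.
Proof.
by rewrite d_zbarE normc_sqr; case: (dx w z) (dy w z) => a b [c d] /=; field.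
Qed.

Lemma jacobianE (w : R * R -> R * R) z :
  Defs.jacobian w z = (dx w z).1 * (dy w z).2 - (dx w z).2 * (dy w z).1.
Proof.
rewrite /Defs.jacobian normc_d_z_sqr normc_d_zbar_sqr.
by case: (dx w z) (dy w z) => a b [c d] /=; field.
Qed.

Lemma gradsq_grad_norm (w : R * R -> R * R) z :
  gradsq w z <= 2 * grad_norm w z ^+ 2.
Proof.
have n1 := normc_ge0 (d_z w z); have n2 := normc_ge0 (d_zbar w z).
have := mulr_ge0 n1 n2; rewrite /grad_norm sqrrD.
have := normc_d_z_sqr w z; have := normc_d_zbar_sqr w z; rewrite /gradsq.
move: (complex.ComplexField.Normc.normc _) (complex.ComplexField.Normc.normc _).
by case: (dx w z) (dy w z) => a b [c d] /= p q; lra.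
Qed.

(** By continuity a violation would fill a square, and squares have positive
    measure. *)
Lemma ae_le0_everywhere D (f : R * R -> R) : open D ->
  (forall z, D z -> {for z, continuous f}) ->
  {ae plane_measure, forall z, D z -> f z <= 0} ->
  forall z, D z -> f z <= 0.
Proof.
move=> oD cf [A [mA A0 fA]] z Dz; rewrite leNgt; apply/negP => fz.
have nD := open_nbhs_nbhs (conj oD Dz).
have nf : nbhs z [set z' | 0 < f z'].
  exact: (@cvgr_gt R _ (nbhs z) _ f (f z) (cf z Dz) 0 fz).
have [e e0 He] := near_box (filterI nD nf).
pose I (t : R) : set R := `[t - e, t + e]%classic.
have IA : I z.1 `*` I z.2 `<=` A.
  move=> z' []; rewrite /I /= !in_itv/= => h1 h2; apply: fA => /= H.
  have [Dz' fz'] : D z' /\ 0 < f z'.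
    by apply: (He z'); split; rewrite ler_distl.
  by move: (H Dz'); rewrite leNgt fz'.
have mI t : measurable (I t) by exact: measurable_itv.
have lI t : lebesgue_measure (I t) = (2 * e)%:E.
  rewrite /I lebesgue_measure_itv/= lte_fin ifT; last lra.
  by rewrite -EFinB; congr (_%:E); ring.
have : (plane_measure (I z.1 `*` I z.2) <= plane_measure A)%E.
  apply: le_measure; rewrite ?inE//.
  exact: (measurableX (mI z.1) (mI z.2)).
have -> : plane_measure (I z.1 `*` I z.2) = ((2 * e)%:E * (2 * e)%:E)%E.
  rewrite -{1}(lI z.1) -(lI z.2).
  exact: (@product_measure1E _ _ _ _ R (@lebesgue_measure R)
    (@lebesgue_measure R) _ _ (mI z.1) (mI z.2)).
rewrite A0 -EFinM lee_fin leNgt.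
by rewrite mulr_gt0// mulr_gt0.
Qed.

Lemma class_C1_continuous_components D (w : R * R -> R * R) z :
  class_C 1 D w -> D z ->
  [/\ {for z, continuous (fun z => (dx w z).1)},
      {for z, continuous (fun z => (dx w z).2)},
      {for z, continuous (fun z => (dy w z).1)} &
      {for z, continuous (fun z => (dy w z).2)}].
Proof.
move=> /class_C1E /[apply] -[_ _ _ cx cy].
exact: (And4 (continuous_proj1 cx) (continuous_proj2 cx) (continuous_proj1 cy)
  (continuous_proj2 cy)).
Qed.

Lemma gradsq_continuous D (w : R * R -> R * R) z :
  class_C 1 D w -> D z -> {for z, continuous (gradsq w)}.
Proof.
move=> Cw Dz; have [c1 c2 c3 c4] := class_C1_continuous_components Cw Dz.
exact: (cvgD (cvgD (cvgD (cvgM c1 c1) (cvgM c2 c2)) (cvgM c3 c3)) (cvgM c4 c4)).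
Qed.

Lemma jacobian_continuous D (w : R * R -> R * R) z :
  class_C 1 D w -> D z -> {for z, continuous (Defs.jacobian w)}.
Proof.
move=> Cw Dz; have [c1 c2 c3 c4] := class_C1_continuous_components Cw Dz.
rewrite (_ : Defs.jacobian w = (fun z => (dx w z).1 * (dy w z).2
  - (dx w z).2 * (dy w z).1)); last by apply/funext => z'; exact: jacobianE.
exact: (cvgB (cvgM c1 c4) (cvgM c2 c3)).
Qed.

Lemma quasiregular_everywhere D (w : R * R -> R * R) (K K' : R) :
  open D -> class_C 1 D w ->
  {ae plane_measure, forall z, D z ->
     grad_norm w z ^+ 2 <= K * Defs.jacobian w z + K'} ->
  forall z, D z -> gradsq w z <= 2 * K * Defs.jacobian w z + 2 * K'.
Proof.
move=> oD Cw H z Dz; rewrite -subr_le0.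
apply: (@ae_le0_everywhere D
  (fun z => gradsq w z - (2 * K * Defs.jacobian w z + 2 * K')) oD) Dz => [x Dx|].
- have cj := jacobian_continuous Cw Dx; have cg := gradsq_continuous Cw Dx.
  exact: (cvgB cg (cvgD (cvgM (cvg_cst (2 * K)) cj) (cvg_cst (2 * K')))).
- case: H => A [mA A0 sA]; exists A; split=> //.
  apply: subset_trans sA => x /= nx hx; apply: nx => Dx.
  by have := hx Dx; have := gradsq_grad_norm w x; lra.
Qed.

Lemma is_derive_pair (f g : R * R -> R) z v a b :
  is_derive z v f a -> is_derive z v g b ->
  is_derive z v (fun x => (f x, g x)) (a, b).
Proof.
move=> [df <-{a}] [dg <-{b}].
have hl : h^-1 *: ((f (h *: v + z), g (h *: v + z)) - (f z, g z))
    @[h --> 0^'] --> ('D_v f z, 'D_v g z).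
  exact: (@cvg_pair _ _ _ _ (nbhs ('D_v f z)) (nbhs ('D_v g z))
            _ _ _ _ _ df dg).
by split; [apply/cvg_ex; exists ('D_v f z, 'D_v g z)|exact: cvg_lim hl].
Qed.

(** [w_(z zbar)] is a quarter of the Laplacian; the mixed partials cancel. *)
Lemma d_zbar_d_z D (w : R * R -> R * R) z : open D -> class_C 2 D w -> D z ->
  d_zbar (fun u => plane_of (d_z w u)) z =
  Complex (((dx (dx w) z).1 + (dy (dy w) z).1) / 4)
          (((dx (dx w) z).2 + (dy (dy w) z).2) / 4).
Proof.
move=> oD Cw Dz; have mixed := class_C2_mixed oD Cw Dz.
have [_ /class_C1E/(_ _ Dz)[_ xx xy _ _] /class_C1E/(_ _ Dz)[_ yx yy _ _]] :=
  class_C2_C1 Cw.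
pose f u := 2^-1 *: ((dx w u).1 + (dy w u).2).
pose g u := 2^-1 *: ((dx w u).2 - (dy w u).1).
have E : (fun u => plane_of (d_z w u)) = (fun u => (f u, g u)).
  apply/funext => u; rewrite d_zE /plane_of/= /f /g /GRing.scale/=.
  by congr pair; rewrite mulrC.
have Dx : dx (fun u => (f u, g u)) z =
    (2^-1 * ((dx (dx w) z).1 + (dx (dy w) z).2),
     2^-1 * ((dx (dx w) z).2 - (dx (dy w) z).1)).
  have [//] := is_derive_pair
    (is_deriveZ 2^-1 (is_deriveD (is_derive_proj1 xx) (is_derive_proj2 yx)))
    (is_deriveZ 2^-1 (is_deriveB (is_derive_proj2 xx) (is_derive_proj1 yx))).
have Dy : dy (fun u => (f u, g u)) z =
    (2^-1 * ((dy (dx w) z).1 + (dy (dy w) z).2),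
     2^-1 * ((dy (dx w) z).2 - (dy (dy w) z).1)).
  have [//] := is_derive_pair
    (is_deriveZ 2^-1 (is_deriveD (is_derive_proj1 xy) (is_derive_proj2 yy)))
    (is_deriveZ 2^-1 (is_deriveB (is_derive_proj2 xy) (is_derive_proj1 yy))).
rewrite E; clear E; clearbody f g.
rewrite (d_zbarE (fun u => (f u, g u)) z).
rewrite Dx.
rewrite Dy.
clear Dx Dy; move: mixed.
generalize (dx (dx w) z), (dy (dx w) z), (dx (dy w) z), (dy (dy w) z).
by move=> [a b] [c d] [p q] [r s] [-> ->] /=; congr Complex; field.
Qed.

End PointwiseData.

(** * The Laplacian of a harmonic map for an approximately analytic metric *)

Section MetricBound.
Context {R : realType}.
Local Notation normc := complex.ComplexField.Normc.normc.
Implicit Types (z : R * R) (D Omega : set (R * R)) (rho : R * R -> R).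

Lemma is_derive_affine_inv (U V W : normedModType R) (A : U -> V) (u : V -> W)
    x v v' l : (forall h : R, A (h *: v + x) = h *: v' + A x) ->
  is_derive x v (u \o A) l -> is_derive (A x) v' u l.
Proof.
move=> hA [du ul].
have E : (fun h => h^-1 *: (((u \o A) \o shift x) (h *: v) - (u \o A) x))
       = (fun h => h^-1 *: ((u \o shift (A x)) (h *: v') - u (A x))).
  by apply/funext => h /=; rewrite hA.
by split; [rewrite /derivable -E|rewrite /derive -E].
Qed.

Lemma is_derive_chain (h : R * R -> R) (g : R -> R) z v l g' :
  is_derive z v h l -> is_derive (h z) 1 g g' ->
  is_derive z v (g \o h) (g' * l).
Proof.
pose A (t : R) := t *: v + z.
have hA k : A (k *: 1 + 0) = k *: v + A 0.
  by rewrite /A [k *: 1]mulr1 addr0 scale0r add0r.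
have A0 : z = A 0 by rewrite /A scale0r add0r.
rewrite {1 2 3}A0 => dh dg; apply: (is_derive_affine_inv (A := A) hA).
exact: (is_derive1_comp dg (is_derive_affine hA dh)).
Qed.

Lemma dx_real_valued (h : R * R -> R) z a :
  is_derive z ex h a -> dx (real_valued h) z = (a, 0).
Proof. by move=> H; have [_] := is_derive_pair H (is_derive_cst 0 z ex). Qed.

Lemma dy_real_valued (h : R * R -> R) z a :
  is_derive z ey h a -> dy (real_valued h) z = (a, 0).
Proof. by move=> H; have [_] := is_derive_pair H (is_derive_cst 0 z ey). Qed.

(** [(log rho)_z = rho_z / rho], and [|rho_z| = |rho_zbar|] because [rho] is
    real. *)
Lemma log_density_bounded Omega rho :
  conformal_C1_metric Omega rho ->
  approximately_analytic Omega (real_valued rho) ->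
  exists2 C : R, 0 <= C &
    forall z, Omega z -> normc (log_density_d_z rho z) <= C.
Proof.
move=> [/class_C1E C1 rho0] [_ [C C0 HC]]; exists C => // z Oz.
have [_ rx ry _ _] := C1 z Oz; have r0 := rho0 z Oz.
have lnr : is_derive (rho z) 1 (@ln R) (rho z)^-1 by exact: is_derive1_ln.
have L2 : (normc (log_density_d_z rho z) * rho z) ^+ 2 =
          (dx rho z ^+ 2 + dy rho z ^+ 2) / 4.
  rewrite exprMn /log_density_d_z normc_d_z_sqr.
  rewrite (dx_real_valued (is_derive_chain rx lnr)).
  rewrite (dy_real_valued (is_derive_chain ry lnr)) /=.
  move: (dx rho z) (dy rho z) (rho z) r0 => a b r /lt0r_neq0 rn0.
  by field.
have := HC z Oz; have := normc_d_zbar_sqr (real_valued rho) z.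
rewrite (dx_real_valued rx) (dy_real_valued ry) /=.
have -> : cabs (real_valued rho z) = rho z.
  by rewrite /cabs /= expr0n/= addr0 sqrtr_sqr gtr0_norm.
move: (normc_ge0 (d_zbar (real_valued rho) z)) => n0 n2 nC.
rewrite -(ler_pM2r r0); apply: le_trans nC.
rewrite -(@ler_pXn2r _ 2)// ?nnegrE//; last first.
  by rewrite mulr_ge0// ?normc_ge0// ltW.
rewrite L2 n2 le_eqVlt; apply/orP; left; apply/eqP.
by move: (dx rho z) (dy rho z) => a b; field.
Qed.

Lemma normc_opp (c : R[i]%C) : normc (- c) = normc c.
Proof. by case: c => a b; rewrite -[- _]/(Complex (- a) (- b)) /= !sqrrN. Qed.

Lemma normc_d_z_d_zbar (w : R * R -> R * R) z :
  normc (d_z w z) * normc (d_zbar w z) <= gradsq w z / 4.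
Proof.
have := normc_d_z_sqr w z; have := normc_d_zbar_sqr w z; rewrite /gradsq.
generalize (normc (d_z w z)), (normc (d_zbar w z)), (dx w z), (dy w z).
by move=> p q [a b] [c d] /=; have := sqr_ge0 (p - q); lra.
Qed.

(** The equation bounds [|Delta w|] by a multiple of [|w_z| |w_zbar|], which
    the arithmetic-geometric mean inequality bounds by the squared gradient. *)
Lemma harmonic_laplacian_bound D Omega rho (w : R * R -> R * R) : open D ->
  conformal_C1_metric Omega rho ->
  approximately_analytic Omega (real_valued rho) ->
  rho_harmonic rho D Omega w ->
  exists2 C : R, 0 <= C & forall z, D z ->
    `|(dx (dx w) z).1 + (dy (dy w) z).1| <= C * gradsq w z /\
    `|(dx (dx w) z).2 + (dy (dy w) z).2| <= C * gradsq w z.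
Proof.
move=> oD cm aa [wD Cw eqn].
have [C C0 HC] := log_density_bounded cm aa; exists C => // z Dz.
have := eqn z Dz; rewrite (d_zbar_d_z oD Cw Dz).
have Lz := HC (w z) (wD _ (ex_intro2 _ _ z Dz erefl)).
move/eqP; rewrite addr_eq0 => /eqP/(congr1 (fun c => normc c)).
rewrite normc_opp.
rewrite (complex.ComplexField.Normc.normcM (_ * _) (d_zbar w z)).
rewrite (complex.ComplexField.Normc.normcM _ (d_z w z)) => E.
have pq := normc_d_z_d_zbar w z.
have Eb : normc (Complex (((dx (dx w) z).1 + (dy (dy w) z).1) / 4)
    (((dx (dx w) z).2 + (dy (dy w) z).2) / 4)) <= C * (gradsq w z / 4).
  rewrite E -mulrA; apply: ler_pM => //; first exact: normc_ge0.
  by apply: mulr_ge0; exact: normc_ge0.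
move: Eb; rewrite mulrA; generalize ((dx (dx w) z).1 + (dy (dy w) z).1),
  ((dx (dx w) z).2 + (dy (dy w) z).2), (C * gradsq w z).
clear => a b N Eb.
have part (t s : R) :
    `|t| <= normc (Complex t s) /\ `|s| <= normc (Complex t s).
  by rewrite -!sqrtr_sqr !ler_sqrt ?addr_ge0 ?sqr_ge0// lerDl lerDr !sqr_ge0.
have [p1 p2] := part (a / 4) (b / 4).
have n4 (t : R) : `|t| = 4 * `|t / 4|.
  by rewrite normrM (@gtr0_norm _ (4^-1))//; field.
by rewrite (n4 a) (n4 b); move: p1 p2 Eb; lra.
Qed.

End MetricBound.

(** * The Euclidean norm and arc length *)

Section PlaneNorm.
Context {R : realType}.
Implicit Types a b p q : R * R.

Definition dot a b : R := a.1 * b.1 + a.2 * b.2.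

Lemma cabs_sqr a : cabs a ^+ 2 = a.1 ^+ 2 + a.2 ^+ 2.
Proof. exact: normc_sqr. Qed.

Lemma cabs_ge0 a : 0 <= cabs a.
Proof. exact: normc_ge0. Qed.

Lemma cabs_triangle a b : cabs (a + b) <= cabs a + cabs b.
Proof. exact: (@le_normcD R (cplx a) (cplx b)). Qed.

Lemma cabsN a : cabs (- a) = cabs a.
Proof. exact: (normc_opp (cplx a)). Qed.

Lemma cabsB a b : cabs (a - b) = cabs (b - a).
Proof. by rewrite -opprB cabsN. Qed.

Lemma cabs_triangle3 p q a : cabs (p - a) <= cabs (p - q) + cabs (q - a).
Proof. by have := cabs_triangle (p - q) (q - a); rewrite addrA subrK. Qed.

Lemma cabs_comp a : `|a.1| <= cabs a /\ `|a.2| <= cabs a.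
Proof.
split; rewrite -(@ler_pXn2r _ 2)// ?nnegrE ?cabs_ge0// cabs_sqr real_normK
  ?num_real// ?lerDl ?lerDr ?sqr_ge0//.
Qed.

Lemma cabs_le_sum a : cabs a <= `|a.1| + `|a.2|.
Proof.
rewrite -(@ler_pXn2r _ 2)// ?nnegrE ?cabs_ge0 ?addr_ge0// cabs_sqr sqrrD.
by rewrite !real_normK ?num_real// -addrA lerD2l lerDr mulrn_wge0 ?mulr_ge0.
Qed.

Lemma dot_le a b : `|dot a b| <= cabs a * cabs b.
Proof.
rewrite -(@ler_pXn2r _ 2)// ?nnegrE ?mulr_ge0 ?cabs_ge0//.
rewrite real_normK ?num_real// exprMn !cabs_sqr /dot -subr_ge0.
rewrite (_ : _ - _ = (a.1 * b.2 - a.2 * b.1) ^+ 2) ?sqr_ge0//.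
by case: a b => x y [s t] /=; ring.
Qed.

Lemma cabs_gt0 a b : a <> b -> 0 < cabs (a - b).
Proof.
move=> ab; rewrite lt_def cabs_ge0 andbT; apply/negP => /eqP E; apply: ab.
have [] := cabs_comp (a - b); rewrite E !normr_le0 !subr_eq0.
by case: a b {E} => x y [s t] /= /eqP -> /eqP ->.
Qed.

End PlaneNorm.

Section ArcLength.
Context {R : realType}.
Implicit Types G : R -> R * R.

Lemma arc_length_le G (k s t : R) : s <= t ->
  (forall a b, s <= a -> a <= b -> b <= t -> cabs (G b - G a) <= k * (b - a)) ->
  (arc_length G s t <= (k * (t - s))%:E)%E.
Proof.
move=> st HG; apply: ub_ereal_sup => _ [p Hp <-]; rewrite lee_fin.
have [pth /eqP lst] := Hp.
apply: (@le_trans _ _ (\sum_(i < size p)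
   (k * nth t (s :: p) i.+1 - k * nth t (s :: p) i))).
  apply: ler_sum => i _; rewrite -mulrBr; apply: HG.
  - by apply: itv_partition_nth_ge Hp => //; rewrite ltnS ltnW.
  - by rewrite ltW//; exact: (pathP t pth i (ltn_ord i)).
  - by apply: itv_partition_nth_le Hp => //; rewrite ltnS.
rewrite -(big_mkord xpredT (fun i => k * nth t (s :: p) i.+1
   - k * nth t (s :: p) i)) telescope_sumr//=.
have -> : nth t (s :: p) (size p) = t.
  by rewrite nth_last /= -[RHS]lst; case: (p).
by rewrite mulrBr.
Qed.

End ArcLength.

Section RegularCurve.
Context {R : realType}.

Lemma near_interval (P : set R) (t0 : R) : nbhs t0 P ->
  exists2 e : R, 0 < e & forall t, `|t - t0| < e -> P t.
Proof.
case/nbhs_ballP => e /= e0 He; exists e => // t ht.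
by apply: He; rewrite /ball/= distrC.
Qed.

(** The velocity and the acceleration are arguments, for the same reason as the
    partial derivatives in [C2_on]. *)
Definition C2_loop (G dG ddG : R -> R * R) (l : R) :=
  [/\ forall t : R, is_derive t 1 G (dG t),
      forall t : R, is_derive t 1 dG (ddG t), continuous ddG, 0 < l
    & forall t, G (t + l) = G t].

(** A curve whose velocity vanishes at [t0] is [1/2]-Lipschitz near [t0], so
    it cannot be parameterized by arc length there. *)
Lemma speed_neq0 G dG ddG l (t0 : R) : C2_loop G dG ddG l ->
  (forall s t, 0 <= s -> s <= t -> t <= l -> arc_length G s t = (t - s)%:E) ->
  0 <= t0 <= l -> dG t0 <> 0.
Proof.
move=> [GD dGD _ l0 _] Glen ht0 E.
have G1 t := is_derive_proj1 (GD t).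
have G2 t := is_derive_proj2 (GD t).
have dG1 t := is_derive_proj1 (dGD t).
have dG2 t := is_derive_proj2 (dGD t).
have q0 : 0 < 4^-1 :> R by rewrite invr_gt0.
have c1 := is_derive_continuous (dG1 t0).
have c2 := is_derive_continuous (dG2 t0).
have N1 : nbhs t0 [set t | `|(dG t).1| < 4^-1].
  apply: (@cvgr_lt R _ (nbhs t0) _ _ _ (cvg_norm c1)).
  by rewrite E normr0.
have N2 : nbhs t0 [set t | `|(dG t).2| < 4^-1].
  apply: (@cvgr_lt R _ (nbhs t0) _ _ _ (cvg_norm c2)).
  by rewrite E normr0.
have [e e0 He] := near_interval (filterI N1 N2).
pose s := Num.max 0 (t0 - e / 2); pose t := Num.min l (t0 + e / 2).
have [hs ht] : 0 <= s /\ t <= l by rewrite /s /t le_max lexx ge_min lexx.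
have [hs' ht'] : t0 - e / 2 <= s /\ t <= t0 + e / 2.
  by rewrite /s /t le_max ge_min !lexx !orbT.
have st : s < t.
  rewrite /s /t lt_min !gt_max; case/andP: ht0 => t0a t0b.
  apply/andP; split; apply/andP; split; lra.
have sml (r : R) : s <= r <= t -> `|(dG r).1| <= 4^-1 /\ `|(dG r).2| <= 4^-1.
  move=> hr; have hr' : `|r - t0| < e.
    by rewrite ltr_distl; lra.
  by have [h1 h2] := He r hr'; split; apply: ltW.
have := @arc_length_le R G 2^-1 s t (ltW st).
rewrite (Glen _ _ hs (ltW st) ht) lee_fin => len.
suff /len : forall a b, s <= a -> a <= b -> b <= t ->
  cabs (G b - G a) <= 2^-1 * (b - a) by lra.
move=> a b sa ab bt.
have ha : s <= a <= t by lra. have hb : s <= b <= t by lra.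
have m1 := MVT_bound ha hb (fun r _ => G1 r) (fun r hr => (sml r hr).1).
have m2 := MVT_bound ha hb (fun r _ => G2 r) (fun r hr => (sml r hr).2).
apply: le_trans (cabs_le_sum _) _; move: m1 m2.
by rewrite (@ger0_norm _ (b - a)) ?subr_ge0//=; lra.
Qed.

End RegularCurve.

(** * Uniform contact of the boundary curve with its tangents *)

Section LoopContact.
Context {R : realType}.

Lemma cabs_continuous : continuous (@cabs R).
Proof.
move=> z; rewrite (_ : @cabs R =
    Num.sqrt \o (fun z : R * R => z.1 ^+ 2 + z.2 ^+ 2)).
  apply: continuous_comp; last exact: sqrt_continuous.
  by apply: cvgD; apply: cvgM; first [exact: cvg_fst|exact: cvg_snd].
by apply/funext => -[].
Qed.

(** The mean value theorem is applied twice; the points [s] and [t] may come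
    in either order. *)
Lemma second_order_taylor (g dg ddg : R -> R) (a b M s t : R) :
  (forall r : R, is_derive r 1 g (dg r)) ->
  (forall r : R, is_derive r 1 dg (ddg r)) ->
  (forall r, a <= r <= b -> `|ddg r| <= M) ->
  a <= s <= b -> a <= t <= b ->
  `|g s - g t - (s - t) * dg t| <= M * (s - t) ^+ 2.
Proof.
move=> gD dgD bM hs ht.
pose lo := Num.min s t; pose hi := Num.max s t.
have hs' : lo <= s <= hi by rewrite /lo /hi ge_min le_max lexx.
have ht' : lo <= t <= hi by rewrite /lo /hi ge_min le_max lexx !orbT.
have [al hb] : a <= lo /\ hi <= b.
  by rewrite /lo /hi le_min ge_max; move: hs ht => /andP[-> ->] /andP[-> ->].
have lohi r : lo <= r <= hi -> `|r - t| <= `|s - t| /\ a <= r <= b.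
  move=> /andP[lr rh]; split; last by rewrite (le_trans al)//= (le_trans rh).
  move: lr rh; rewrite /lo /hi; case: (leP s t) => st.
    by move=> lr rh; rewrite (@ler0_norm _ (s - t)) ?subr_le0// ler_norml; lra.
  by move=> lr rh; rewrite (@gtr0_norm _ (s - t)) ?subr_gt0// ler_norml; lra.
have [c hc ->] := MVT_between ht' hs' (fun r _ => gD r).
have [ct _] := lohi _ hc.
have [d hd E] := MVT_between ht' hc (fun r _ => dgD r).
have [_ hdab] := lohi _ hd.
have -> : dg c * (s - t) - (s - t) * dg t = (dg c - dg t) * (s - t) by ring.
rewrite E !normrM -mulrA -(@real_normK _ (s - t)) ?num_real// expr2.
by apply: ler_pM => //; rewrite ?mulr_ge0 ?bM//; apply: ler_pM.
Qed.

Lemma continuous_segment_bounded (f : R -> R) (a b : R) : continuous f ->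
  a <= b -> exists M, forall t, a <= t <= b -> `|f t| <= M.
Proof.
move=> cf ab.
have cn : {within `[a, b], continuous (fun t => `|f t|)}.
  apply: continuous_subspaceT => t.
  exact: (cvg_norm (cf t)).
have [c _ Hc] := EVT_max ab cn.
by exists `|f c| => t ht; apply: Hc; rewrite in_itv.
Qed.

Lemma C2_loop_taylor (G dG ddG : R -> R * R) (l : R) : C2_loop G dG ddG l ->
  exists2 M, 0 < M & forall s t, - l <= s <= 2 * l -> - l <= t <= 2 * l ->
    cabs (G s - G t - (s - t) *: dG t) <= M * (s - t) ^+ 2.
Proof.
move=> [GD dGD ddGc l0 _].
have ab : - l <= 2 * l by lra.
have [M1 H1] := continuous_segment_bounded
  (fun t => continuous_proj1 (ddGc t)) ab.
have [M2 H2] := continuous_segment_bounded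
  (fun t => continuous_proj2 (ddGc t)) ab.
have M10 : 0 <= M1 by apply: le_trans (H1 0 _); rewrite ?normr_ge0//; lra.
have M20 : 0 <= M2 by apply: le_trans (H2 0 _); rewrite ?normr_ge0//; lra.
exists (M1 + M2 + 1); first lra.
move=> s t hs ht; apply: le_trans (cabs_le_sum _) _.
have T1 := second_order_taylor (fun r => is_derive_proj1 (GD r))
  (fun r => is_derive_proj1 (dGD r)) H1 hs ht.
have T2 := second_order_taylor (fun r => is_derive_proj2 (GD r))
  (fun r => is_derive_proj2 (dGD r)) H2 hs ht.
apply: le_trans (lerD T1 T2) _.
by rewrite -mulrDl ler_wpM2r ?sqr_ge0//; lra.
Qed.

(** An injective closed curve does not come back close to itself: compactness
    of the pairs of parameters at distance at least [d] on the circle of length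
    [l]. *)
Lemma loop_far_separated (G dG ddG : R -> R * R) (l d : R) :
  C2_loop G dG ddG l ->
  (forall s t, 0 <= s < l -> 0 <= t < l -> G s = G t -> s = t) -> 0 < d ->
  exists2 eta, 0 < eta & forall s t, 0 <= s <= l -> 0 <= t <= l ->
    d <= `|s - t| <= l - d -> eta <= cabs (G s - G t).
Proof.
move=> [GD _ _ l0 Gper] Ginj d0.
(* pairs of parameters that are far apart on the circle of length [l] *)
pose T : set (R * R) := (`[0, l] `*` `[0, l]) `&`
  ((fun z => `|z.1 - z.2|) @^-1` `[d, l - d]%classic).
have TP s t :
    T (s, t) <-> [/\ 0 <= s <= l, 0 <= t <= l & d <= `|s - t| <= l - d].
  by rewrite /T /= !in_itv/=; split=> [[[]]|[]].
have cT : compact T.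
  apply: compact_closedI; first by apply: compact_setX; exact: segment_compact.
  apply: preimage_closed; last exact: itv_closed.
  move=> z _; apply: cvg_norm; apply: cvgB; first exact: cvg_fst.
  exact: cvg_snd.
have Gc (t : R) : {for t, continuous G}.
  by have [/derivable1_diffP/differentiable_continuous] := GD t.
have cF : {within T, continuous (fun z : R * R => cabs (G z.1 - G z.2))}.
  apply: continuous_subspaceT => z.
  have f1 : {for z, continuous (fst : R * R -> R)} by exact: cvg_fst.
  have f2 : {for z, continuous (snd : R * R -> R)} by exact: cvg_snd.
  have c1 : {for z, continuous (fun z : R * R => G z.1)}.
    exact: (cvg_comp _ _ f1 (Gc z.1)).
  have c2 : {for z, continuous (fun z : R * R => G z.2)}.
    exact: (cvg_comp _ _ f2 (Gc z.2)).
  exact: (cvg_comp _ _ (cvgB c1 c2) (@cabs_continuous (G z.1 - G z.2))).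
have [T0|T0] := pselect (T !=set0); last first.
  by exists 1 => // s t hs ht hst; case: T0; exists (s, t); apply/TP.
have [[s0 t0] + Hmin] := compact_EVT_min T0 cT cF.
rewrite inE => /TP[hs ht hst].
exists (cabs (G s0 - G t0)); last first.
  by move=> s t ? ? ?; apply: (Hmin (s, t)); rewrite inE; apply/TP.
apply: cabs_gt0.
wlog st : s0 t0 hs ht hst {Hmin} / t0 <= s0.
  move=> W; have [|/ltW] := leP t0 s0; first exact: W.
  by move=> st /esym; apply: W => //; rewrite distrC.
move: hst; rewrite ger0_norm ?subr_ge0// => hst E.
have [sl|sl] := eqVneq s0 l.
  have G0 : G 0 = G t0 by rewrite -E sl -(Gper 0) add0r.
  suff : 0 = t0 by lra.
  by apply: Ginj G0; lra.
have sl' : s0 < l by rewrite lt_neqAle sl; case/andP: hs.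
suff : s0 = t0 by lra.
by apply: Ginj E; lra.
Qed.

End LoopContact.

Section TangentBalls.
Context {R : realType}.
Implicit Types (G dG ddG : R -> R * R) (n : R * R).

Lemma dotDl a b n : dot (a + b) n = dot a n + dot b n :> R.
Proof. by rewrite /dot /=; ring. Qed.

Lemma dotZl (k : R) a n : dot (k *: a) n = k * dot a n.
Proof. by rewrite /dot /= /GRing.scale/=; ring. Qed.

Lemma cabsZ (k : R) (a : R * R) : cabs (k *: a) = `|k| * cabs a.
Proof.
apply/eqP; rewrite -(@eqrXn2 _ 2)// ?mulr_ge0 ?cabs_ge0//.
rewrite exprMn real_normK ?num_real// !cabs_sqr /= /GRing.scale/=.
by apply/eqP; ring.
Qed.

Lemma speed_bound G dG ddG l : C2_loop G dG ddG l ->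
  (forall t, 0 <= t <= l -> dG t <> 0) ->
  exists2 c, 0 < c & forall t, 0 <= t <= l -> c <= cabs (dG t).
Proof.
move=> [GD dGD _ l0 _] dG0.
have cf : {within `[0, l], continuous (fun t => cabs (dG t))}.
  apply: continuous_subspaceT => t.
  have [/derivable1_diffP/differentiable_continuous c _] := dGD t.
  exact: (cvg_comp _ _ c (@cabs_continuous R (dG t))).
have [t0 ht0 Hmin] := EVT_min (ltW l0) cf.
exists (cabs (dG t0)).
  rewrite -[dG t0]subr0; apply: cabs_gt0; apply: dG0.
  by rewrite in_itv in ht0.
by move=> t ht; apply: Hmin; rewrite in_itv.
Qed.

(** The displacement [D] is a multiple of the tangent vector [v] up to a
    quadratic error [e].  For small [k] it has length at least [c |k| / 2], while
    only [e] contributes to its component along the normal [n]. *)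
Lemma loop_near_contact (D e v n : R * R) (c M k : R) :
  0 < c -> 0 < M -> D = e + k *: v -> dot v n = 0 -> c <= cabs v ->
  cabs e <= M * k ^+ 2 -> `|k| <= c / (2 * M) ->
  `|dot D n| <= 4 * M / c ^+ 2 * cabs n * cabs D ^+ 2.
Proof.
move=> c0 M0 -> vn cv eM kM; rewrite dotDl dotZl vn mulr0 addr0.
have k2 : k ^+ 2 = `|k| ^+ 2 by rewrite real_normK ?num_real.
have kv : `|k| * c <= cabs (e + k *: v) + cabs e.
  apply: (@le_trans _ _ (`|k| * cabs v)); first by rewrite ler_wpM2l.
  rewrite -cabsZ -(cabsN e).
  by have := cabs_triangle (e + k *: v) (- e); rewrite addrAC subrr add0r.
have Mk : M * k ^+ 2 <= c / 2 * `|k|.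
  rewrite k2 expr2 mulrA ler_wpM2r//.
  by rewrite mulrC -ler_pdivlMr// -mulrA -invfM.
have Dk : c / 2 * `|k| <= cabs (e + k *: v) by lra.
have Dk2 : k ^+ 2 <= 4 / c ^+ 2 * cabs (e + k *: v) ^+ 2.
  have : (c / 2 * `|k|) ^+ 2 <= cabs (e + k *: v) ^+ 2.
    by rewrite ler_pXn2r// ?nnegrE ?cabs_ge0// mulr_ge0// divr_ge0// ltW.
  rewrite exprMn -k2 => H.
  have -> : k ^+ 2 = 4 / c ^+ 2 * ((c / 2) ^+ 2 * k ^+ 2).
    by field; rewrite gt_eqF.
  by rewrite ler_wpM2l// divr_ge0// sqr_ge0.
apply: le_trans (dot_le _ _) _.
apply: (@le_trans _ _ (M * (4 / c ^+ 2 * cabs (e + k *: v) ^+ 2) * cabs n)).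
  rewrite ler_wpM2r ?cabs_ge0//; apply: le_trans eM _.
  by rewrite ler_wpM2l// ltW.
by rewrite le_eqVlt; apply/orP; left; apply/eqP; ring.
Qed.

(** Close parameters are handled by the Taylor expansion, after a shift by a
    period if they are close across the base point.  For distant parameters the
    chord is bounded below and any constant large enough will do. *)
Lemma loop_quadratic_contact G dG ddG l : C2_loop G dG ddG l ->
  (forall s t, 0 <= s < l -> 0 <= t < l -> G s = G t -> s = t) ->
  (forall t, 0 <= t <= l -> dG t <> 0) ->
  exists2 C, 0 < C & forall s t n, 0 <= s <= l -> 0 <= t <= l ->
    dot (dG t) n = 0 ->
    `|dot (G s - G t) n| <= C * cabs n * cabs (G s - G t) ^+ 2.
Proof.
move=> HG Ginj dG0; have [GD dGD _ l0 Gper] := HG.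
have [c c0 Hc] := speed_bound HG dG0.
have [M M0 HM] := C2_loop_taylor HG.
have d0 : 0 < c / (2 * M) by rewrite divr_gt0// mulr_gt0.
have [eta eta0 Heta] := loop_far_separated HG Ginj d0.
set d := c / (2 * M) in d0 Heta.
have C10 : 0 < 4 * M / c ^+ 2 by rewrite divr_gt0 ?mulr_gt0 ?exprn_gt0.
have e10 : 0 < eta^-1 by rewrite invr_gt0.
exists (4 * M / c ^+ 2 + eta^-1); first by rewrite addr_gt0.
move=> s t n hs ht vn.
have sq : 0 <= cabs n * cabs (G s - G t) ^+ 2.
  by rewrite mulr_ge0 ?cabs_ge0 ?sqr_ge0.
have near_case s' : G s' = G s -> - l <= s' <= 2 * l -> `|s' - t| <= d ->
   `|dot (G s - G t) n| <=
     (4 * M / c ^+ 2 + eta^-1) * cabs n * cabs (G s - G t) ^+ 2.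
  move=> <- hs' hd; have ht' : - l <= t <= 2 * l by lra.
  apply: (@le_trans _ _ (4 * M / c ^+ 2 * cabs n * cabs (G s' - G t) ^+ 2)).
    apply: (@loop_near_contact _ (G s' - G t - (s' - t) *: dG t) (dG t) n c M
      (s' - t)) => //; first by rewrite subrK.
    - exact: Hc.
    - exact: HM.
  rewrite -mulrA -[leRHS]mulrA ler_wpM2r ?lerDl ?(ltW e10)//.
  by rewrite mulr_ge0 ?cabs_ge0 ?sqr_ge0.
have [h1|h1] := leP `|s - t| d; first by apply: (near_case s) => //; lra.
have [h2|h2] := leP `|s - t| (l - d).
  have := Heta s t hs ht; rewrite (ltW h1) h2 => /(_ isT) He.
  apply: le_trans (dot_le _ _) _.
  apply: (@le_trans _ _ (eta^-1 * cabs n * cabs (G s - G t) ^+ 2)).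
    have -> : cabs (G s - G t) * cabs n = 1 * cabs (G s - G t) * cabs n by ring.
    have -> : eta^-1 * cabs n * cabs (G s - G t) ^+ 2
       = eta^-1 * cabs (G s - G t) * cabs (G s - G t) * cabs n by ring.
    rewrite ler_wpM2r ?cabs_ge0// ler_wpM2r ?cabs_ge0//.
    by rewrite mulrC ler_pdivlMr// mul1r.
  rewrite -mulrA -[leRHS]mulrA ler_wpM2r// lerDr ltW//.
have [st|st] := leP t s.
  move: h2; rewrite ger0_norm ?subr_ge0// => h2.
  apply: (near_case (s - l)); first by rewrite -(Gper (s - l)) subrK.
    by lra.
  by rewrite ler_norml; lra.
move: h2; rewrite ltr0_norm ?subr_lt0// => h2.
apply: (near_case (s + l)); first exact: Gper.
  by lra.
by rewrite ler_norml; lra.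
Qed.

End TangentBalls.

(** * Nearest boundary points and tangent discs *)

Section Projection.
Context {R : realType}.
Implicit Types (G dG ddG : R -> R * R) (zeta : R * R).
Implicit Types (gamma : set (R * R)) (P : R * R -> R * R).

(** By periodicity the minimum over one period is a minimum over an open
    interval that contains both ends, so that the first-order condition holds
    also at the base point. *)
Lemma nearest_point_normal G dG ddG l zeta : C2_loop G dG ddG l ->
  exists t, [/\ 0 <= t <= l,
    forall s, 0 <= s <= l -> cabs (zeta - G t) <= cabs (zeta - G s) &
    dot (dG t) (zeta - G t) = 0].
Proof.
move=> [GD dGD _ l0 Gper].
pose g1 s := zeta.1 - (G s).1; pose g2 s := zeta.2 - (G s).2.
pose f s := g1 s * g1 s + g2 s * g2 s.
have g1D (s : R) : is_derive s 1 g1 (0 - (dG s).1).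
  exact: (is_deriveB (is_derive_cst _ _ _) (is_derive_proj1 (GD s))).
have g2D (s : R) : is_derive s 1 g2 (0 - (dG s).2).
  exact: (is_deriveB (is_derive_cst _ _ _) (is_derive_proj2 (GD s))).
have fD (s : R) := is_deriveD (is_deriveM (g1D s) (g1D s))
                              (is_deriveM (g2D s) (g2D s)).
have fE s : cabs (zeta - G s) ^+ 2 = f s by rewrite cabs_sqr /f /g1 /g2 !expr2.
have cf : {within `[0, l], continuous f}.
  by apply: continuous_subspaceT => s; exact: is_derive_continuous (fD s).
have [t ht Hmin] := EVT_min (ltW l0) cf.
have {}Hmin s : 0 <= s <= l -> f t <= f s.
  by move=> hs; apply: Hmin; rewrite in_itv.
rewrite in_itv/= in ht; exists t; split=> //.
  move=> s hs; rewrite -(@ler_pXn2r _ 2)// ?nnegrE ?cabs_ge0//.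
  by rewrite !fE; exact: Hmin.
have fper s : f (s + l) = f s by rewrite /f /g1 /g2 Gper.
have Hall s : s \in `]- l, (2 * l)[%R -> f t <= f s.
  rewrite in_itv/= => hs.
  have [s0|s0] := ltP s 0; first by rewrite -(fper s); apply: Hmin; lra.
  have [sl|sl] := leP s l; first by apply: Hmin; lra.
  have -> : f s = f (s - l) by rewrite -(fper (s - l)) subrK.
  by apply: Hmin; lra.
have [_ f0] : is_derive t 1 f 0.
  apply: (@derive1_at_min R f (- l) (2 * l) t _ _ _ Hall).
  - by lra.
  - by move=> s _; have [] := fD s.
  - by rewrite in_itv/=; lra.
have [_] := fD t; rewrite f0 /dot /= /GRing.scale/= /g1 /g2.
by lra.
Qed.

(** [P] is a choice of nearest points on [gamma], together with a uniform bound
    on the deviation of [gamma] from the line through [P zeta] perpendicular to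
    [zeta - P zeta]. *)
Definition projects_onto gamma (C : R) P := forall zeta,
  [/\ gamma (P zeta),
    forall q, gamma q -> cabs (zeta - P zeta) <= cabs (zeta - q)
    & forall q, gamma q -> `|dot (q - P zeta) (zeta - P zeta)| <=
        C * cabs (zeta - P zeta) * cabs (q - P zeta) ^+ 2].

Lemma smooth_curve_projection alpha gamma : Cna_Jordan_curve 2 alpha gamma ->
  exists2 C, 0 < C & exists P, projects_onto gamma C P.
Proof.
move=> [l [G [[[l0 Gc Gper Ginj gE] Glen] [GD Gcn] _]]].
have D1 (t : R) : is_derive t 1 G (derive1n 1 G t).
  by rewrite derive1n1 derive1E; exact: (derivableP (GD 0%N isT t)).
have D2 (t : R) : is_derive t 1 (derive1n 1 G) (derive1n 2 G t).
  by rewrite (derive1nS G 1) derive1E; exact: (derivableP (GD 1%N isT t)).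
have HG := And5 D1 D2 (Gcn 2%N isT) l0 Gper : C2_loop G _ _ l.
have dG0 t : 0 <= t <= l -> derive1n 1 G t <> 0 by exact: speed_neq0 HG Glen.
have [C C0 HC] := loop_quadratic_contact HG Ginj dG0.
exists C => //.
have H zeta : exists p, [/\ gamma p,
    forall q, gamma q -> cabs (zeta - p) <= cabs (zeta - q)
  & forall q, gamma q -> `|dot (q - p) (zeta - p)| <=
        C * cabs (zeta - p) * cabs (q - p) ^+ 2].
  have [t [ht Hmin Hn]] := nearest_point_normal zeta HG.
  exists (G t); rewrite gE; split; first by exists t.
  - by move=> _ [s hs <-]; exact: Hmin.
  - by move=> _ [s hs <-]; exact: HC.
by exists (fun zeta => sval (cid (H zeta))) => zeta; case: cid.
Qed.

Section ProjectionFacts.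
Context {gamma : set (R * R)} {C : R} {P : R * R -> R * R}.
Context (C0 : 0 < C) (HP : projects_onto gamma C P).

Definition pdist P zeta := cabs (zeta - P zeta).

Lemma pdist_lip zeta zeta' :
  pdist P zeta <= cabs (zeta - zeta') + pdist P zeta'.
Proof.
have [_ H _] := HP zeta; have [g _ _] := HP zeta'.
exact: le_trans (H _ g) (cabs_triangle3 _ _ _).
Qed.

Lemma pdist_continuous : continuous (pdist P).
Proof.
move=> z; apply/cvgrPdist_lt => e e0.
have c : {for z, continuous (fun x : R * R => cabs (z - x))}.
  exact: (cvg_comp _ _ (cvgB (cvg_cst z) cvg_id) (@cabs_continuous R (z - z))).
have cz : cabs (z - z) < e.
  by rewrite subrr /cabs /= expr0n addr0 sqrtr0.
near=> x.
have hx : cabs (z - x) < e.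
  by near: x; exact: (@cvgr_lt R _ (nbhs z) _ _ _ c e cz).
have h1 := pdist_lip z x; have := pdist_lip x z; rewrite (cabsB x z) => h2.
by rewrite ltr_norml; apply/andP; split; lra.
Unshelve. all: by end_near. Qed.

(** The contact bound says exactly that [gamma] does not enter the disc of
    radius [(2 C)^-1] that touches it at [P zeta] and whose centre [c] lies in
    the direction of [zeta]; the rest is the triangle inequality. *)
Lemma tangent_ball zeta : 0 < pdist P zeta -> pdist P zeta < (2 * C)^-1 ->
  exists2 c, cabs (zeta - c) = (2 * C)^-1 - pdist P zeta
  & forall zeta', (2 * C)^-1 - cabs (zeta' - c) <= pdist P zeta'.
Proof.
move=> d0 dr; set r := (2 * C)^-1 in dr *; set d := pdist P zeta in d0 dr *.
have r0 : 0 < r by rewrite invr_gt0 mulr_gt0.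
have dn : d != 0 by rewrite gt_eqF.
have [gp Hmin Hcon] := HP zeta.
pose c := P zeta + (r / d) *: (zeta - P zeta); exists c.
  have -> : zeta - c = (1 - r / d) *: (zeta - P zeta).
    by rewrite scalerBl scale1r /c opprD addrA.
  rewrite cabsZ -/(pdist P zeta) -/d ler0_norm; first by field.
  by rewrite subr_le0 ler_pdivlMr// mul1r ltW.
have far q : gamma q -> r <= cabs (q - c).
  move=> gq; rewrite -(@ler_pXn2r _ 2)// ?nnegrE ?cabs_ge0 ?(ltW r0)//.
  have := Hcon q gq; rewrite -/(pdist P zeta) -/d => /(le_trans (ler_norm _)) H.
  have -> : q - c = (q - P zeta) - (r / d) *: (zeta - P zeta).
    by rewrite /c opprD addrA.
  have exp (a b : R * R) (k : R) : cabs (a - k *: b) ^+ 2 =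
      cabs a ^+ 2 - 2 * k * dot a b + k ^+ 2 * cabs b ^+ 2.
    by rewrite !cabs_sqr /dot /= /GRing.scale/=; ring.
  rewrite exp -/(pdist P zeta) -/d.
  have -> : (r / d) ^+ 2 * d ^+ 2 = r ^+ 2 by field.
  rewrite lerDr subr_ge0.
  apply: (@le_trans _ _ (2 * (r / d) * (C * d * cabs (q - P zeta) ^+ 2))).
    by rewrite ler_wpM2l// mulr_ge0// divr_ge0// ltW.
  rewrite le_eqVlt; apply/orP; left; apply/eqP; rewrite /r.
  by field; rewrite dn gt_eqF.
move=> zeta'; have [g' _ _] := HP zeta'; rewrite lerBlDr.
apply: le_trans (far _ g') _; rewrite /pdist (cabsB zeta' (P zeta')).
exact: cabs_triangle3.
Qed.

End ProjectionFacts.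
End Projection.

(** * Decay of the distance to the boundary *)

Section Barrier.
Context {R : realType}.
Implicit Types (z c : R * R) (D : set (R * R)) (w P : R * R -> R * R).

(** A polynomial substitute for the distance [1 - |z|] to the circle, to which
    it is comparable. *)
Definition depth z : R := 1 - z.1 ^+ 2 - z.2 ^+ 2.

Lemma depth_cabs z : depth z = 1 - cabs z ^+ 2.
Proof. by rewrite cabs_sqr /depth opprD addrA. Qed.

Lemma unit_disc_depth z : unit_disc z <-> 0 < depth z.
Proof.
by rewrite /unit_disc /= depth_cabs subr_gt0 expr_lt1// cabs_ge0.
Qed.

Lemma depth_continuous : continuous depth.
Proof.
move=> z.
have f1 : {for z, continuous (fst : R * R -> R)} by exact: cvg_fst.
have f2 : {for z, continuous (snd : R * R -> R)} by exact: cvg_snd.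
have g1 : {for z, continuous (fun z : R * R => z.1 ^+ 2)}.
  exact: (cvgM f1 f1).
have g2 : {for z, continuous (fun z : R * R => z.2 ^+ 2)}.
  exact: (cvgM f2 f2).
have g0 : {for z, continuous (fun z : R * R => 1 : R)} by exact: cvg_cst.
exact: (cvgB (cvgB g0 g1) g2).
Qed.

Lemma unit_disc_open : open (@unit_disc R).
Proof.
rewrite (_ : unit_disc = depth @^-1` [set x | 0 < x]).
  by apply: open_comp => [z _|]; [exact: depth_continuous|exact: open_gt].
by apply/seteqP; split=> z /unit_disc_depth.
Qed.

Lemma C2_on_barrier D (A b : R) :
  C2_on D (fun z => A * depth z - b * depth z ^+ 2)
   (fun z => - 2 * z.1 * (A - 2 * b * depth z))
   (fun z => - 2 * z.2 * (A - 2 * b * depth z))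
   (fun z => - 2 * (A - 2 * b * depth z) - 8 * b * z.1 ^+ 2)
   (fun z => - 2 * (A - 2 * b * depth z) - 8 * b * z.2 ^+ 2).
Proof.
have X := @C2_on_fst R D; have Y := @C2_on_snd R D.
have S := C2_onD (C2_onD (C2_on_cst (D := D) 1) (C2_onZ (-1) (C2_onM X X)))
                 (C2_onZ (-1) (C2_onM Y Y)).
have := C2_onD (C2_onZ A S) (C2_onZ (- b) (C2_onM S S)).
by apply: C2_on_eq => -[x y]; rewrite /depth /=; ring.
Qed.

Lemma C2_on_sqdist D (u ux uy uxx uyy v vx vy vxx vyy : R * R -> R)
    (p q k m : R) :
  C2_on D u ux uy uxx uyy -> C2_on D v vx vy vxx vyy ->
  C2_on D (fun z => k + m * ((u z - p) ^+ 2 + (v z - q) ^+ 2))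
   (fun z => 2 * m * ((u z - p) * ux z + (v z - q) * vx z))
   (fun z => 2 * m * ((u z - p) * uy z + (v z - q) * vy z))
   (fun z => 2 * m * (ux z ^+ 2 + vx z ^+ 2
                      + ((u z - p) * uxx z + (v z - q) * vxx z)))
   (fun z => 2 * m * (uy z ^+ 2 + vy z ^+ 2
                      + ((u z - p) * uyy z + (v z - q) * vyy z))).
Proof.
move=> Du Dv.
have U := C2_onD Du (C2_on_cst (D := D) (- p)).
have V := C2_onD Dv (C2_on_cst (D := D) (- q)).
have := C2_onD (C2_on_cst (D := D) k)
  (C2_onZ m (C2_onD (C2_onM U U) (C2_onM V V))).
by apply: C2_on_eq => z; ring.
Qed.

(** In the frame formed by [n] and its rotation, the Jacobian is
    [ux vy - uy vx]; completing squares absorbs the component orthogonal to [n]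
    into the left-hand side. *)
Lemma directional_control w z n (K K' : R) : cabs n = 1 ->
  gradsq w z <= 2 * K * Defs.jacobian w z + 2 * K' ->
  gradsq w z <= 4 * K ^+ 2 * (dot (dx w z) n ^+ 2 + dot (dy w z) n ^+ 2)
                + 4 * K'.
Proof.
move=> n1; rewrite jacobianE /gradsq /dot.
have nn : n.1 ^+ 2 + n.2 ^+ 2 = 1 by rewrite -cabs_sqr n1 expr1n.
generalize (dx w z), (dy w z) => -[a1 a2] [b1 b2] /=.
move: nn; case: n {n1} => n1 n2 /= nn.
pose ux := a1 * n1 + a2 * n2; pose uy := b1 * n1 + b2 * n2.
pose vx := a2 * n1 - a1 * n2; pose vy := b2 * n1 - b1 * n2.
have N1 : a1 ^+ 2 + a2 ^+ 2 + b1 ^+ 2 + b2 ^+ 2 =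
    ux ^+ 2 + uy ^+ 2 + vx ^+ 2 + vy ^+ 2.
  transitivity ((a1 ^+ 2 + a2 ^+ 2 + b1 ^+ 2 + b2 ^+ 2) * (n1 ^+ 2 + n2 ^+ 2)).
    by rewrite nn mulr1.
  by rewrite /ux /uy /vx /vy; ring.
have J1 : a1 * b2 - a2 * b1 = ux * vy - uy * vx.
  transitivity ((a1 * b2 - a2 * b1) * (n1 ^+ 2 + n2 ^+ 2)).
    by rewrite nn mulr1.
  by rewrite /ux /uy /vx /vy; ring.
rewrite N1 J1 -/ux -/uy; clearbody ux uy vx vy; clear.
have := sqr_ge0 (vy - 2 * K * ux); have := sqr_ge0 (vx + 2 * K * uy).
have := sqr_ge0 ux; have := sqr_ge0 uy.
lra.
Qed.

(** The last inequality is what the touching argument gives for the Laplacian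
    of the barrier [A depth - b depth^2], whose derivative in the depth is [f].
    It bounds this Laplacian from below in terms of the squared gradient of the
    barrier, whereas the value of [b] makes it more negative than that. *)
Lemma barrier_arithmetic (m K K' N ax ay x y A f b : R) :
  0 < m -> N <= 4 * K ^+ 2 * (ax ^+ 2 + ay ^+ 2) + 4 * K' ->
  ax = - 2 * x * f -> ay = - 2 * y * f ->
  b = (m * (4 * K ^+ 2) + 1) * A ^+ 2 / 2 -> A / 2 <= f -> f <= A -> 0 < A ->
  m * (4 * K') < A ->
  - m * N <= - 2 * f - 8 * b * x ^+ 2 + (- 2 * f - 8 * b * y ^+ 2) -> False.
Proof.
move=> m0 HN eax eay -> f1 f2 A0 hA H; rewrite {}eax {}eay in HN.
have f2A : f ^+ 2 <= A ^+ 2 by rewrite ler_pXn2r// nnegrE; lra.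
have T : m * N <= m * (4 * K ^+ 2 * ((- 2 * x * f) ^+ 2 + (- 2 * y * f) ^+ 2)
                       + 4 * K') by rewrite ler_pM2l.
have q : 0 <= m * (4 * K ^+ 2) * (x ^+ 2 + y ^+ 2).
  apply: mulr_ge0; last by rewrite addr_ge0 ?sqr_ge0.
  by apply: mulr_ge0; [exact: ltW|apply: mulr_ge0 => //; exact: sqr_ge0].
have q2 : m * (4 * K ^+ 2) * (x ^+ 2 + y ^+ 2) * f ^+ 2 <=
          m * (4 * K ^+ 2) * (x ^+ 2 + y ^+ 2) * A ^+ 2 by rewrite ler_wpM2l.
have q3 : 0 <= A ^+ 2 * (x ^+ 2 + y ^+ 2).
  by rewrite mulr_ge0 ?addr_ge0 ?sqr_ge0.
lra.
Qed.

End Barrier.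

Section Touching.
Context {R : realType}.
Implicit Types (z c : R * R) (D : set (R * R)) (w P : R * R -> R * R).

Definition pde_controlled D w (K K' B : R) :=
  class_C 2 D w /\ forall z, D z ->
  [/\ gradsq w z <= 2 * K * Defs.jacobian w z + 2 * K',
      `|(dx (dx w) z).1 + (dy (dy w) z).1| <= B * gradsq w z &
      `|(dx (dx w) z).2 + (dy (dy w) z).2| <= B * gradsq w z].

Lemma dot_laplacian_le (n1 n2 L1 L2 S : R) : n1 ^+ 2 + n2 ^+ 2 = 1 ->
  `|L1| <= S -> `|L2| <= S -> `|n1 * L1 + n2 * L2| <= 2 * S.
Proof.
move=> n12 h1 h2.
have S0 : 0 <= S by apply: le_trans h1.
have le1 (a b : R) : a ^+ 2 + b ^+ 2 = 1 -> `|a| <= 1.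
  move=> ab; rewrite -(@ler_pXn2r _ 2)// ?nnegrE// real_normK ?num_real//.
  by rewrite expr1n; have := sqr_ge0 b; lra.
have a1 := le1 _ _ n12; have a2 := le1 n2 n1; rewrite addrC n12 in a2.
apply: le_trans (ler_normD _ _) _; rewrite !normrM.
have : `|n1| * `|L1| <= 1 * S by apply: ler_pM.
have : `|n2| * `|L2| <= 1 * S by apply: ler_pM => //; exact: a2.
lra.
Qed.

(** The distance to the boundary need not be differentiable.  The tangent disc
    at the nearest point replaces it by a function that lies below it and agrees
    at [z1], and this function of [w] again has a local maximum against the
    barrier.  The distance to the centre of the disc is further replaced, by the
    arithmetic-geometric mean inequality, by its square, so that the touching
    function is polynomial in [w]. *)
Lemma barrier_no_contact w P gamma (C K K' B A b e : R) z1 : 0 < C ->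
  projects_onto gamma C P -> pde_controlled unit_disc w K K' B -> 0 <= B ->
  let d := pdist P (w z1) in let r := (2 * C)^-1 in
  let m := 2 * B + 2 / r in let f := A - 2 * b * depth z1 in
  0 < d -> d <= r / 2 -> 0 < e ->
  (forall z', `|z'.1 - z1.1| < e -> `|z'.2 - z1.2| < e -> unit_disc z' /\
     pdist P (w z') - (A * depth z' - b * depth z' ^+ 2) <=
     d - (A * depth z1 - b * depth z1 ^+ 2)) ->
  b = (m * (4 * K ^+ 2) + 1) * A ^+ 2 / 2 -> A / 2 <= f -> f <= A -> 0 < A ->
  m * (4 * K') < A -> False.
Proof.
move=> C0 HP [Cw Hw] B0 d r m f d0 dr e0 Hmax bE f1 f2 A0 hA.
have r0 : 0 < r by rewrite invr_gt0 mulr_gt0.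
have dr' : d < r by lra.
have [c cw Hc] := tangent_ball C0 HP d0 dr'.
rewrite -/d -/r in cw Hc.
(* the distance from [w z1] to the centre of the tangent disc *)
set rh := r - d in cw.
have rh0 : 0 < rh by rewrite /rh; lra.
have rh2 : r / 2 <= rh by rewrite /rh; lra.
have rhn : rh != 0 by rewrite gt_eqF.
have [W1 W2] := class_C2_components Cw.
have Dz1 : unit_disc z1.
  by have [] := Hmax z1; rewrite ?subrr ?normr0.
have T := C2_onD
  (C2_on_sqdist c.1 c.2 (r - rh / 2) (- (2 * rh)^-1) W1 W2)
  (C2_onZ (-1) (C2_on_barrier (D := unit_disc) A b)).
have tE z' : r - rh / 2 + - (2 * rh)^-1 *
    (((w z').1 - c.1) ^+ 2 + ((w z').2 - c.2) ^+ 2) =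
    r - rh / 2 - cabs (w z' - c) ^+ 2 / (2 * rh).
  by rewrite cabs_sqr mulNr [X in _ - X]mulrC.
have tle z' : r - rh / 2 - cabs (w z' - c) ^+ 2 / (2 * rh) <= pdist P (w z').
  apply: le_trans (Hc (w z')).
  rewrite -subr_ge0 [leRHS](_ : _ = (cabs (w z' - c) - rh) ^+ 2 / (2 * rh)).
    by rewrite divr_ge0 ?sqr_ge0// mulr_ge0// ltW.
  by field.
have t1 : r - rh / 2 - cabs (w z1 - c) ^+ 2 / (2 * rh) = d.
  by rewrite cw /rh; field; rewrite -/rh.
have [z' h1 h2|gx gy lap] := local_max_laplacian (z := z1) e0 T.
  have [D' H] := Hmax z' h1 h2; split=> //.
  rewrite !tE t1 !mulN1r; apply: le_trans (H); rewrite lerD2r; exact: tle.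
have [Hq Hl1 Hl2] := Hw z1 Dz1.
pose n : R * R := (- rh^-1) *: (w z1 - c).
have n1 : cabs n = 1.
  by rewrite /n cabsZ cw normrN gtr0_norm ?invr_gt0// mulVf.
have HN := directional_control n1 Hq.
have dxE : dot (dx w z1) n = - 2 * z1.1 * f.
  move: gx; rewrite /f /dot /n /= /GRing.scale/=.
  generalize (dx w z1), (w z1), (depth z1) => -[a1 a2] [p q] s /= gx.
  apply/eqP; rewrite -subr_eq0 -[X in _ == X]gx; apply/eqP.
  by field.
have dyE : dot (dy w z1) n = - 2 * z1.2 * f.
  move: gy; rewrite /f /dot /n /= /GRing.scale/=.
  generalize (dy w z1), (w z1), (depth z1) => -[a1 a2] [p q] s /= gy.
  apply/eqP; rewrite -subr_eq0 -[X in _ == X]gy; apply/eqP.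
  by field.
have m0 : 0 < m.
  by rewrite /m ltr_wpDl ?divr_gt0// mulr_ge0.
apply: (barrier_arithmetic m0 HN dxE dyE bE f1 f2 A0 hA).
have nn : n.1 ^+ 2 + n.2 ^+ 2 = 1 by rewrite -cabs_sqr n1 expr1n.
have := dot_laplacian_le nn Hl1 Hl2.
have N0 := gradsq_ge0 w z1.
have irh : rh^-1 <= 2 / r.
  have -> : 2 / r = (r / 2)^-1 by rewrite invf_div.
  by rewrite lef_pV2// posrE divr_gt0.
have := ler_wpM2r N0 irh.
rewrite ler_norml => h /andP[h' _].
move: lap h h'; rewrite /m -/f /n /= /GRing.scale/=.
have -> : gradsq w z1 = (dx w z1).1 ^+ 2 + (dx w z1).2 ^+ 2
  + (dy w z1).1 ^+ 2 + (dy w z1).2 ^+ 2 by [].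
have -> : 2 * - (2 * rh)^-1 = - rh^-1 by field.
clear.
generalize (dx w z1), (dy w z1), (dx (dx w) z1), (dy (dy w) z1), (w z1).
move=> [a1 a2] [b1 b2] [xx1 xx2] [yy1 yy2] [p q] /=.
move: (rh^-1) (2 / r) => i k; lra.
Qed.

End Touching.

Section BoundaryDecay.
Context {R : realType}.
Implicit Types (z : R * R) (w P : R * R -> R * R).

Lemma small_near_boundary (h : R * R -> R) (eps : R) : 0 < eps ->
  compact (unit_disc `&` [set z | eps <= h z]) ->
  exists2 k : R, 0 < k & forall z, unit_disc z -> depth z <= k -> h z < eps.
Proof.
move=> e0 cS; set S := _ `&` _ in cS.
have [S0|S0] := pselect (S !=set0); last first.
  exists 1 => // z Dz _; rewrite ltNge; apply/negP => hz.
  by apply: S0; exists z.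
have cd : {within S, continuous (@depth R)}.
  by apply: continuous_subspaceT; exact: depth_continuous.
have [z0 + Hmin] := compact_EVT_min S0 cS cd.
rewrite inE => -[/unit_disc_depth d0 _]; exists (depth z0 / 2).
  by rewrite divr_gt0.
move=> z Dz dz; rewrite ltNge; apply/negP => hz.
have Sz : S z by split.
have := Hmin z; rewrite inE => /(_ Sz); lra.
Qed.

(** Near the circle the distance is below the values that make the barrier
    dominate it on the inner boundary of the annulus [depth <= s0].  By properness
    a positive excess over the barrier is attained inside this annulus, against
    [barrier_no_contact]. *)
Lemma boundary_decay w P gamma (C K K' B : R) : 0 < C ->
  projects_onto gamma C P -> pde_controlled unit_disc w K K' B ->
  0 <= B -> 0 <= K' ->
  (forall z, unit_disc z -> 0 < pdist P (w z)) ->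
  (forall eps, 0 < eps ->
     compact (unit_disc `&` [set z | eps <= pdist P (w z)])) ->
  exists A s0 : R, [/\ 0 < A, 0 < s0 & forall z, unit_disc z -> depth z <= s0 ->
    pdist P (w z) <= A * depth z].
Proof.
move=> C0 HP Hw B0 K'0 dpos dcpt.
pose r := (2 * C)^-1; pose m := 2 * B + 2 / r.
have r0 : 0 < r by rewrite invr_gt0 mulr_gt0.
have m0 : 0 < m by rewrite /m ltr_wpDl ?divr_gt0// mulr_ge0.
pose C4 := m * (4 * K ^+ 2) + 1; pose C5 := m * (4 * K').
have C40 : 0 < C4.
  by rewrite /C4 ltr_wpDl// (mulr_ge0 (ltW m0))// mulr_ge0// sqr_ge0.
have C50 : 0 <= C5 by rewrite /C5 (mulr_ge0 (ltW m0))// mulr_ge0.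
have e0 : 0 < Num.min (r / 2) (3 / (8 * C4)).
  by rewrite lt_min !divr_gt0// mulr_gt0.
have [k k0 Hk] := small_near_boundary e0 (dcpt _ e0).
have ik : 0 < (C4 * k)^-1 by rewrite invr_gt0 mulr_gt0.
(* [A] beats the constant term [C5] and makes [s0] at most [k]; [b] makes the
   quadratic term of the barrier absorb [C4] times its squared gradient *)
pose A := C5 + (C4 * k)^-1.
have A0 : 0 < A by rewrite /A; lra.
have hA : m * (4 * K') < A by rewrite -/C5 /A; lra.
pose b := C4 * A ^+ 2 / 2; pose s0 := (2 * C4 * A)^-1.
have s00 : 0 < s0 by rewrite invr_gt0 !mulr_gt0.
have b0 : 0 < b by rewrite divr_gt0// mulr_gt0// exprn_gt0.
have s0k : s0 <= k.
  rewrite /s0 -[leRHS]invrK lef_pV2 ?posrE ?invr_gt0 ?mulr_gt0//.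
  apply: (@le_trans _ _ (C4 * (C4 * k)^-1)).
    by rewrite invfM mulrA divff ?mul1r// gt_eqF.
  have : C4 * (C4 * k)^-1 <= C4 * A by rewrite ler_pM2l// /A; lra.
  by have : 0 <= C4 * A; [rewrite mulr_ge0// ltW|rewrite -mulrA; lra].
have An : A != 0 by rewrite gt_eqF.
have C4n : C4 != 0 by rewrite gt_eqF.
have bs0 : 2 * b * s0 = A / 2 by rewrite /b /s0; field; rewrite An C4n.
(* the value of the barrier on the inner circle does not depend on [A] *)
have psis0 : A * s0 - b * s0 ^+ 2 = 3 / (8 * C4).
  by rewrite /b /s0; field; rewrite An C4n.
pose psi z := A * depth z - b * depth z ^+ 2.
have small z : unit_disc z -> depth z <= s0 ->
    pdist P (w z) < r / 2 /\ pdist P (w z) < 3 / (8 * C4).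
  by move=> Dz dz; have := Hk z Dz (le_trans dz s0k); rewrite lt_min => /andP.
have fbound z : unit_disc z -> depth z <= s0 ->
    A / 2 <= A - 2 * b * depth z /\ A - 2 * b * depth z <= A.
  move=> /unit_disc_depth d0 ds.
  have : 2 * b * depth z <= 2 * b * s0 by rewrite ler_pM2l// mulr_gt0.
  have : 0 <= 2 * b * depth z by rewrite mulr_ge0 ?(ltW d0)// ltW// mulr_gt0.
  by rewrite bs0; split; lra.
have psi0 z : unit_disc z -> depth z <= s0 -> 0 <= psi z.
  move=> Dz ds; have [f1 _] := fbound z Dz ds.
  have d0 := (unit_disc_depth z).1 Dz.
  rewrite /psi (_ : _ - _ = depth z * (A - b * depth z)); last by ring.
  by rewrite mulr_ge0 ?(ltW d0)//; lra.
exists A, s0; split=> // z0 Dz0 dz0.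
suff : pdist P (w z0) <= psi z0.
  move=> /le_trans; apply; rewrite /psi lerBlDr lerDl.
  by rewrite (mulr_ge0 (ltW b0))// sqr_ge0.
rewrite leNgt; apply/negP => contra.
pose eps := pdist P (w z0) - psi z0.
have eps0 : 0 < eps by rewrite /eps; lra.
pose S := (unit_disc `&` [set z | eps <= pdist P (w z)])
  `&` (@depth R @^-1` [set t | t <= s0]).
have cS : compact S.
  apply: compact_closedI; first exact: dcpt.
  apply: preimage_closed; last exact: closed_le.
  by move=> z _; exact: depth_continuous.
have Sz0 : S z0.
  split=> //; split=> //=; rewrite /eps.
  by have := psi0 z0 Dz0 dz0; lra.
have Cw1 : forall z, unit_disc z -> {for z, continuous w}.
  by move=> z Dz; case: Hw.1 => c _; exact: c.
have cF : {within S, continuous (fun z => pdist P (w z) - psi z)}.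
  apply: continuous_in_subspaceT => z; rewrite inE => -[[Dz _] _].
  have c1 : {for z, continuous (fun z => pdist P (w z))}.
    have cz := Cw1 z Dz.
    have cP : {for (w z), continuous (pdist P)} by exact: pdist_continuous HP _.
    exact: (cvg_comp _ _ cz cP).
  have [c2 _ _ _ _] := @C2_on_barrier R unit_disc A b z Dz.
  exact: (cvgB c1 c2).
have [z1 + Hmax] := compact_EVT_max (ex_intro _ z0 Sz0) cS cF.
rewrite inE => -[[Dz1 _] /= dz1].
have epsle : eps <= pdist P (w z1) - psi z1 by apply: (Hmax z0); rewrite inE.
have allmax z : unit_disc z -> depth z <= s0 ->
    pdist P (w z) - psi z <= pdist P (w z1) - psi z1.
  move=> Dz ds; have [h|h] := leP eps (pdist P (w z)).
    by apply: (Hmax z); rewrite inE; split.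
  by have := psi0 z Dz ds; lra.
have dz1' : depth z1 < s0.
  rewrite lt_neqAle dz1 andbT; apply/eqP => E.
  have [_] := small z1 Dz1 dz1; rewrite -psis0.
  by move: epsle eps0; rewrite /psi E; lra.
have N : nbhs z1 (unit_disc `&` (@depth R @^-1` [set t | t < s0])).
  apply: open_nbhs_nbhs; split; last by split.
  apply: openI; first exact: unit_disc_open.
  by apply: open_comp => [z _|]; [exact: depth_continuous|exact: open_lt].
have [e e_0 He] := near_box N.
have [f1 f2] := fbound z1 Dz1 dz1.
have [dr _] := small z1 Dz1 dz1.
apply: (@barrier_no_contact R w P gamma C K K' B A b e z1 C0 HP Hw B0) => //.
- exact: dpos.
- exact: ltW.
- move=> z' h1 h2.
  have [Dz' dz'] : (unit_disc `&` (@depth R @^-1` [set t | t < s0])) z'.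
    by apply: He; split; apply: ltW.
  by split=> //; apply: allmax => //; exact: ltW.
Qed.

End BoundaryDecay.

(** * The gradient up to the boundary *)

Section GradientBound.
Context {R : realType}.
Implicit Types (z : R * R) (D : set (R * R)) (w P : R * R -> R * R).

Lemma box_center z (l : R) : 0 <= l -> box z l z.
Proof. by move=> l0; split; rewrite subrr normr0. Qed.

Lemma box_compact z (l : R) : compact (box z l).
Proof.
rewrite (_ : box z l = `[z.1 - l, z.1 + l] `*` `[z.2 - l, z.2 + l]).
  by apply: compact_setX; exact: segment_compact.
by apply/seteqP; split=> -[x y]; rewrite /box/= !in_itv/= !ler_distl.
Qed.

Lemma depth_box z0 z : unit_disc z0 -> box z0 (depth z0 / 16) z ->
  depth z0 / 2 <= depth z <= 3 / 2 * depth z0.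
Proof.
move=> /unit_disc_depth d0 [h1 h2].
have [c1 c2] : -1 <= z0.1 <= 1 /\ -1 <= z0.2 <= 1.
  have H (t s : R) : t ^+ 2 + s ^+ 2 <= 1 -> -1 <= t <= 1.
    move=> ts; rewrite -ler_norml -(@ler_pXn2r _ 2)// ?nnegrE//.
    by rewrite real_normK ?num_real// expr1n; have := sqr_ge0 s; lra.
  by split; [apply: (H _ z0.2)|apply: (H _ z0.1)]; move: d0; rewrite /depth;
    lra.
have s1 : depth z0 <= 1.
  by rewrite /depth; have := sqr_ge0 z0.1; have := sqr_ge0 z0.2; lra.
have dif (t t0 : R) : -1 <= t0 <= 1 -> `|t - t0| <= depth z0 / 16 ->
    `|t ^+ 2 - t0 ^+ 2| <= 3 * (depth z0 / 16).
  move=> ht0 ht; rewrite subr_sqr normrM mulrC.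
  apply: ler_pM => //; move: ht; rewrite !ler_norml; lra.
have := dif _ _ c1 h1; have := dif _ _ c2 h2.
rewrite !ler_norml /depth in d0 s1 *; lra.
Qed.

(** Doubling: weighting [g] by the distance to the boundary of the square
    gives a point around which [g] at most doubles, at a scale that is not
    lost in the estimate. *)
Lemma doubling_point (g : R * R -> R) z0 (r0 : R) : 0 < r0 ->
  {within box z0 r0, continuous g} -> (forall z, 0 <= g z) -> 0 < g z0 ->
  exists z1 d1, [/\ 0 < d1, d1 <= r0, r0 * g z0 <= d1 * g z1 &
    forall z, box z1 (d1 / 2) z -> box z0 r0 z /\ g z <= 2 * g z1].
Proof.
move=> r00 cg g0 gz0.
(* the distance to the sides of the square *)
pose mu z := r0 - Num.max `|z.1 - z0.1| `|z.2 - z0.2|.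
have cmu : continuous mu.
  move=> z.
  have f1 : {for z, continuous (fst : R * R -> R)} by exact: cvg_fst.
  have f2 : {for z, continuous (snd : R * R -> R)} by exact: cvg_snd.
  have n1 : {for z, continuous (fun z : R * R => `|z.1 - z0.1|)}.
    exact: (cvg_norm (cvgB f1 (cvg_cst z0.1))).
  have n2 : {for z, continuous (fun z : R * R => `|z.2 - z0.2|)}.
    exact: (cvg_norm (cvgB f2 (cvg_cst z0.2))).
  have c0 : {for z, continuous (fun=> r0)} by exact: cvg_cst.
  exact: (cvgB c0 (continuous_max n1 n2)).
have cF : {within box z0 r0, continuous (fun z => mu z * g z)}.
  move=> z; apply: cvgM; last exact: cg.
  exact: (continuous_subspaceT cmu).
have [z1 + Hmax] := compact_EVT_max (ex_intro _ z0 (box_center z0 (ltW r00)))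
  (box_compact (z := z0) (l := r0)) cF.
rewrite inE => Bz1.
have mu0 : mu z0 = r0 by rewrite /mu !subrr normr0 maxxx subr0.
have le1 : r0 * g z0 <= mu z1 * g z1.
  rewrite -{1}mu0; apply: (Hmax z0); rewrite inE.
  by apply: box_center; exact: ltW.
have d10 : 0 < mu z1.
  have : 0 < mu z1 * g z1 by apply: lt_le_trans le1; exact: mulr_gt0.
  rewrite ltNge => /negP H; rewrite ltNge; apply/negP => h; apply: H.
  exact: mulr_le0_ge0.
have maxle (a b c : R) : (Num.max a b <= c) = (a <= c) && (b <= c).
  exact: ge_max.
exists z1, (mu z1); split=> //.
  by rewrite /mu gerBl le_max normr_ge0.
move=> z [h1 h2].
have t1 := ler_distD z1.1 z.1 z0.1; have t2 := ler_distD z1.2 z.2 z0.2.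
have m1 : mu z1 <= r0 - `|z1.1 - z0.1| by rewrite /mu lerD2l lerN2 le_max lexx.
have m2 : mu z1 <= r0 - `|z1.2 - z0.2|.
  by rewrite /mu lerD2l lerN2 le_max lexx orbT.
have hm : mu z1 / 2 <= mu z.
  by rewrite {2}/mu lerBrDr -lerBrDl maxle; apply/andP; split; lra.
have Bz : box z0 r0 z by split; lra.
split=> //.
have h : mu z1 / 2 * g z <= mu z1 * g z1.
  apply: (@le_trans _ _ (mu z * g z)); first by rewrite ler_wpM2r.
  by apply: (Hmax z); rewrite inE.
rewrite -(ler_pM2l d10); lra.
Qed.

Lemma partials_le w z (g : R) : 0 <= g -> gradsq w z <= g ^+ 2 ->
  [/\ `|(dx w z).1| <= g, `|(dx w z).2| <= g, `|(dy w z).1| <= g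
    & `|(dy w z).2| <= g].
Proof.
rewrite /gradsq; generalize (dx w z), (dy w z) => -[a b] [c d] /= g0.
have := sqr_ge0 a; have := sqr_ge0 b; have := sqr_ge0 c; have := sqr_ge0 d.
by move=> *; split; rewrite -(@ler_pXn2r _ 2)// ?nnegrE//;
  rewrite real_normK ?num_real//; lra.
Qed.

(** The mean value theorem along the two legs of the path through the corner
    [(x, y')]. *)
Lemma corner_path_bound D E w (g x y x' y' : R) :
  class_C 1 D w -> E `<=` D -> 0 <= g ->
  (forall z, E z -> gradsq w z <= g ^+ 2) ->
  (forall t, Num.min x' x <= t <= Num.max x' x -> E (t, y')) ->
  (forall t, Num.min y' y <= t <= Num.max y' y -> E (x, t)) ->
  cabs (w (x, y) - w (x', y')) <= 2 * g * (`|x - x'| + `|y - y'|).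
Proof.
move=> /class_C1E Cw ED g0 Ng hseg vseg.
have comp z' (Ez' : E z') := partials_le g0 (Ng z' Ez').
have Dw z' : E z' -> is_derive z' ex w (dx w z') /\ is_derive z' ey w (dy w z').
  by move=> /ED /Cw[].
have [x1 x2] : Num.min x' x <= x' <= Num.max x' x /\
               Num.min x' x <= x <= Num.max x' x.
  by rewrite !ge_min !le_max !lexx !orbT.
have [y1 y2] : Num.min y' y <= y' <= Num.max y' y /\
               Num.min y' y <= y <= Num.max y' y.
  by rewrite !ge_min !le_max !lexx !orbT.
have X1 := MVT_bound x1 x2
  (fun t ht => is_derive_slice_x (is_derive_proj1 (Dw _ (hseg t ht)).1))
  (fun t ht => let: And4 h _ _ _ := comp _ (hseg t ht) in h).
have X2 := MVT_bound x1 x2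
  (fun t ht => is_derive_slice_x (is_derive_proj2 (Dw _ (hseg t ht)).1))
  (fun t ht => let: And4 _ h _ _ := comp _ (hseg t ht) in h).
have Y1 := MVT_bound y1 y2
  (fun t ht => is_derive_slice_y (is_derive_proj1 (Dw _ (vseg t ht)).2))
  (fun t ht => let: And4 _ _ h _ := comp _ (vseg t ht) in h).
have Y2 := MVT_bound y1 y2
  (fun t ht => is_derive_slice_y (is_derive_proj2 (Dw _ (vseg t ht)).2))
  (fun t ht => let: And4 _ _ _ h := comp _ (vseg t ht) in h).
apply: le_trans (cabs_le_sum _) _ => /=.
have T1 := ler_distD (w (x, y')).1 (w (x, y)).1 (w (x', y')).1.
have T2 := ler_distD (w (x, y')).2 (w (x, y)).2 (w (x', y')).2.
move: X1 X2 Y1 Y2 T1 T2; clear.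
generalize `|(w (x, y)).1 - (w (x, y')).1|, `|(w (x, y)).2 - (w (x, y')).2|,
 `|(w (x, y')).1 - (w (x', y')).1|, `|(w (x, y')).2 - (w (x', y')).2|,
 `|(w (x, y)).1 - (w (x', y')).1|, `|(w (x, y)).2 - (w (x', y')).2|.
by move=> *; lra.
Qed.

Lemma box_oscillation D w z1 z (l g : R) : class_C 1 D w -> 0 <= l ->
  box z1 l `<=` D -> 0 <= g -> (forall z, box z1 l z -> gradsq w z <= g ^+ 2) ->
  box z1 l z -> cabs (w z - w z1) <= 4 * g * l.
Proof.
case: z1 z => x1 y1 [x y] Cw l0 BD g0 Ng [/= hx hy].
have between (a b t : R) : `|b - a| <= l ->
    Num.min a b <= t <= Num.max a b -> `|t - a| <= l.
  rewrite !ler_distl ge_min le_max => hb /andP[h1 h2].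
  by apply/andP; split; [case/orP: h1|case/orP: h2]; lra.
have := @corner_path_bound D (box (x1, y1) l) w g x y x1 y1 Cw BD g0 Ng.
move=> /(_ _ _)/le_trans; apply.
- by move=> t /(between _ _ _ hx) ht; split; rewrite //= subrr normr0.
- by move=> t /(between _ _ _ hy) ht.
have -> : 4 * g * l = 2 * g * (l + l) by ring.
by rewrite ler_wpM2l ?mulr_ge0// lerD.
Qed.

End GradientBound.

Section NormalComponent.
Context {R : realType}.
Implicit Types (z : R * R) (D : set (R * R)) (w P : R * R -> R * R).

(** Split [zeta - P zeta1] at the nearest point to [zeta]: the first part is
    short, the second is a chord of [gamma] and has small normal component by
    quadratic contact. *)
Lemma normal_component_bound gamma (C : R) P zeta1 zeta :
  0 <= C -> projects_onto gamma C P -> 0 < pdist P zeta1 ->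
  `|dot (zeta - P zeta1) ((pdist P zeta1)^-1 *: (zeta1 - P zeta1))| <=
  pdist P zeta + C * (pdist P zeta + cabs (zeta - zeta1) + pdist P zeta1) ^+ 2.
Proof.
move=> C0 HP d0; have [gq _ _] := HP zeta; have [_ _ Hcon] := HP zeta1.
set d := pdist P zeta1 in d0 *; set n := _ *: _.
have n1 : cabs n = 1.
  by rewrite /n cabsZ gtr0_norm ?invr_gt0// mulVf// gt_eqF.
have -> : zeta - P zeta1 = (zeta - P zeta) + (P zeta - P zeta1).
  by rewrite addrA subrK.
rewrite dotDl; apply: le_trans (ler_normD _ _) _; apply: lerD.
  by apply: le_trans (dot_le _ _) _; rewrite n1 mulr1.
have -> : dot (P zeta - P zeta1) n =
    d^-1 * dot (P zeta - P zeta1) (zeta1 - P zeta1).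
  by rewrite /n /dot /= /GRing.scale/=; ring.
rewrite normrM gtr0_norm ?invr_gt0//.
apply: (@le_trans _ _ (C * cabs (P zeta - P zeta1) ^+ 2)).
  by rewrite mulrC ler_pdivrMr// mulrAC; exact: Hcon.
have t1 := cabs_triangle3 (P zeta) zeta (P zeta1).
have t2 := cabs_triangle3 zeta zeta1 (P zeta1).
rewrite (cabsB (P zeta) zeta) in t1.
have le : cabs (P zeta - P zeta1) <= pdist P zeta + cabs (zeta - zeta1) + d.
  by rewrite /d /pdist; apply: le_trans t1 _; rewrite -addrA lerD2l.
rewrite ler_wpM2l// ler_pXn2r// nnegrE ?cabs_ge0//.
exact: le_trans (cabs_ge0 _) le.
Qed.

(** The component [u] of [w] normal to the boundary is small, its Laplacian is
    at most of the order of [G^2], and its gradient at [z1] controls [G].  The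
    interior estimate for [u] on the square thus bounds [G] by a small multiple
    of itself, once [l] is chosen well. *)
Lemma gradient_at_doubling gamma w P (C K K' B T G l : R) z1 :
  0 <= C -> projects_onto gamma C P -> 0 <= B -> 0 <= K -> 0 <= K' ->
  pde_controlled unit_disc w K K' B -> 0 < l -> box z1 l `<=` unit_disc ->
  0 < G -> gradsq w z1 = G ^+ 2 ->
  (forall z, box z1 l z -> gradsq w z <= (2 * G) ^+ 2) ->
  0 < pdist P (w z1) -> (forall z, box z1 l z -> pdist P (w z) <= T) ->
  G <= 3 * K * (2 * (T + C * (2 * T + 8 * G * l) ^+ 2) / l
                + (8 * B + 1) * G ^+ 2 * l / 2) + 2 * Num.sqrt K'.
Proof.
move=> C0 HP B0 K0 K'0 [Cw Hw] l0 BD G0 N1 NG d0 dT.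
have [Cw1 _ _] := class_C2_C1 Cw.
have G20 : 0 <= 2 * G by rewrite mulr_ge0// ltW.
have [W1 W2] := class_C2_components Cw.
set d := pdist P (w z1) in d0; pose n := d^-1 *: (w z1 - P (w z1)).
have n1 : cabs n = 1.
  by rewrite /n cabsZ gtr0_norm ?invr_gt0// mulVf// gt_eqF.
have nn : n.1 ^+ 2 + n.2 ^+ 2 = 1 by rewrite -cabs_sqr n1 expr1n.
have U := C2_on_sub BD (C2_onD (C2_on_cst (D := unit_disc) (- dot (P (w z1)) n))
  (C2_onD (C2_onZ n.1 W1) (C2_onZ n.2 W2))).
set S := T + C * (2 * T + 8 * G * l) ^+ 2.
pose F := (8 * B + 1) * G ^+ 2.
have B1 := box_center z1 (ltW l0).
have dT1 := dT _ B1.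
have uS z : box z1 l z ->
    `|- dot (P (w z1)) n + (n.1 * (w z).1 + n.2 * (w z).2)| <= S.
  move=> Bz; have := normal_component_bound (w z) C0 HP d0.
  rewrite -/n (_ : dot _ n =
    - dot (P (w z1)) n + (n.1 * (w z).1 + n.2 * (w z).2)).
    move=> /le_trans; apply; apply: lerD; first exact: dT.
    have le : pdist P (w z) + cabs (w z - w z1) + d <= 2 * T + 8 * G * l.
      have := box_oscillation Cw1 (ltW l0) BD G20 NG Bz.
      by have := dT z Bz; move: dT1; rewrite -/d; clear => *; lra.
    have ge0 : 0 <= pdist P (w z) + cabs (w z - w z1) + d.
      by rewrite !addr_ge0 ?cabs_ge0// ltW.
    by rewrite ler_wpM2l// ler_pXn2r// nnegrE// (le_trans ge0).
  by rewrite /dot /=; ring.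
have uF z : box z1 l z ->
    `|0 + (n.1 * (dx (dx w) z).1 + n.2 * (dx (dx w) z).2) +
      (0 + (n.1 * (dy (dy w) z).1 + n.2 * (dy (dy w) z).2))| < F.
  move=> Bz; have [_ L1 L2] := Hw z (BD _ Bz); have Nz := NG z Bz.
  have := dot_laplacian_le nn L1 L2.
  have -> : n.1 * ((dx (dx w) z).1 + (dy (dy w) z).1) +
     n.2 * ((dx (dx w) z).2 + (dy (dy w) z).2) =
     0 + (n.1 * (dx (dx w) z).1 + n.2 * (dx (dx w) z).2) +
      (0 + (n.1 * (dy (dy w) z).1 + n.2 * (dy (dy w) z).2)).
    generalize (dx (dx w) z), (dy (dy w) z) => -[a b] [p q] /=; ring.
  move=> /le_lt_trans; apply; rewrite /F.
  have BN : B * gradsq w z <= B * (2 * G) ^+ 2 by rewrite ler_wpM2l.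
  have : 0 < G ^+ 2 by rewrite exprn_gt0.
  by move: BN; clear; generalize (gradsq w z) => *; lra.
have gy := poisson_gradient_y l0 U uS uF.
have gx := poisson_gradient_x l0 U uS uF.
set E := 2 * S / l + F * l / 2 in gx gy.
have E0 : 0 <= E by apply: le_trans gx.
have [Hq _ _] := Hw z1 (BD _ B1).
have HN := directional_control n1 Hq.
have sqE (t s : R) : `|t| <= s -> t ^+ 2 <= s ^+ 2.
  move=> ts; rewrite -(real_normK (num_real t)) ler_pXn2r// ?nnegrE//.
  exact: le_trans ts.
have dx2 : dot (dx w z1) n ^+ 2 <= E ^+ 2.
  apply: sqE; apply: le_trans gx; rewrite le_eqVlt; apply/orP; left; apply/eqP.
  by congr `|_|; rewrite /dot; ring.
have dy2 : dot (dy w z1) n ^+ 2 <= E ^+ 2.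
  apply: sqE; apply: le_trans gy; rewrite le_eqVlt; apply/orP; left; apply/eqP.
  by congr `|_|; rewrite /dot; ring.
have k0 : 0 <= Num.sqrt K' by exact: sqrtr_ge0.
have kk : Num.sqrt K' ^+ 2 = K' by rewrite sqr_sqrtr.
rewrite -/F -/E.
move: (Num.sqrt K') k0 kk => k k0 kk.
rewrite -(@ler_pXn2r _ 2)// ?nnegrE ?(ltW G0)//; last first.
  by rewrite addr_ge0// !mulr_ge0.
rewrite -N1; apply: le_trans HN _; rewrite -kk.
move: dx2 dy2; generalize (dot (dx w z1) n ^+ 2), (dot (dy w z1) n ^+ 2).
move=> a b ha hb.
have ab : a + b <= 2 * E ^+ 2 by move: ha hb; clear => *; lra.
have K2 : 4 * K ^+ 2 * (a + b) <= 4 * K ^+ 2 * (2 * E ^+ 2).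
  by apply: ler_wpM2l ab; rewrite mulr_ge0// sqr_ge0.
have KEk : 0 <= K * E * k by rewrite !mulr_ge0.
have KE2 : 0 <= (K * E) ^+ 2 by exact: sqr_ge0.
by move: K2 KEk KE2; clear => *; lra.
Qed.

End NormalComponent.

Section UniformGradientBound.
Context {R : realType}.
Implicit Types (z : R * R) (D : set (R * R)) (w P : R * R -> R * R).

(** At the doubling point the square has half-side [l] with [G l] of the order
    of [lam s].  The two terms of the interior estimate are then of the order of
    [A G / lam] and [lam s G]: the first is absorbed by choosing [lam] large, the
    second by going close to the boundary. *)
Lemma gradient_bounded_near_boundary gamma w P (C K K' B A s0 : R) :
  0 < C -> projects_onto gamma C P -> 0 <= B -> 1 <= K -> 0 <= K' ->
  pde_controlled unit_disc w K K' B ->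
  (forall z, unit_disc z -> 0 < pdist P (w z)) -> 0 < A -> 0 < s0 ->
  (forall z, unit_disc z -> depth z <= s0 -> pdist P (w z) <= A * depth z) ->
  exists M s1 : R, 0 < s1 /\
    forall z, unit_disc z -> depth z <= s1 -> gradsq w z <= M.
Proof.
move=> C0 HP B0 K1 K'0 Hw dpos A0 s00 Hdec.
have K0 : 0 < K by lra.
have [Cw1 _ _] := class_C2_C1 Hw.1.
(* [192] makes the bound on the first term of the interior estimate equal to [G / 4] *)
pose lam := 192 * K * A; pose k := Num.sqrt K'.
have lam0 : 0 < lam by rewrite !mulr_gt0.
have kE : Num.sqrt K' = k by [].
have k0 : 0 <= k by exact: sqrtr_ge0.
clearbody k.
pose c1 := C * (4 * A + 4 * lam) ^+ 2; pose c2 := 3 * K * (8 * B + 1) * lam.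
have c10 : 0 < c1 by rewrite /c1 mulr_gt0// exprn_gt0//; lra.
have c20 : 0 < c2 by rewrite /c2 !mulr_gt0//; lra.
pose s1 := Num.min (2 / 3 * s0) (Num.min (2 * A / c1) (c2^-1)).
have s10 : 0 < s1.
  rewrite /s1 !lt_min; apply/and3P; split; last by rewrite invr_gt0.
    by rewrite mulr_gt0// divr_gt0.
  by apply: divr_gt0 => //; exact: mulr_gt0.
exists ((16 * lam + 4 * k) ^+ 2), s1; split=> // z0 Dz0 dz0.
pose s := depth z0; have sp : 0 < s by exact: (unit_disc_depth z0).1.
have [hs1 hs2 hs3] : [/\ 3 / 2 * s <= s0, c1 * s <= 2 * A & c2 * s <= 1].
  move: dz0; rewrite /s1 !le_min => /and3P[h1 h2 h3]; split.
  - by move: h1; rewrite -/s; lra.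
  - by move: h2; rewrite -/s ler_pdivlMr// mulrC.
  - by move: h3; rewrite -/s -[c2^-1]mul1r ler_pdivlMr// mulrC.
pose r0 := s / 16; have r00 : 0 < r0 by rewrite divr_gt0.
have inD z : box z0 r0 z -> [/\ unit_disc z, depth z <= s0 & depth z <= 2 * s].
  move=> /(depth_box Dz0) /andP[h1 h2]; rewrite -/s in h1 h2; split.
  - by apply/unit_disc_depth; lra.
  - by lra.
  - by lra.
pose g z := Num.sqrt (gradsq w z).
have g0 z : 0 <= g z by exact: sqrtr_ge0.
have gg z : gradsq w z = g z ^+ 2 by rewrite sqr_sqrtr ?gradsq_ge0.
have cg : {within box z0 r0, continuous g}.
  apply: continuous_in_subspaceT => z; rewrite inE => /inD[Dz _ _].
  exact: (cvg_comp _ _ (gradsq_continuous Cw1 Dz) (@sqrt_continuous R _)).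
clearbody g.
suff gz0 : g z0 <= 16 * lam + 4 * k.
  by rewrite gg ler_pXn2r// nnegrE// addr_ge0// mulr_ge0// ltW.
have [gz0|gz0] := leP (g z0) 0.
  by apply: le_trans gz0 _; rewrite addr_ge0// mulr_ge0// ltW.
have [z1 [d1 [d10 d1r le1 Hb]]] := doubling_point r00 cg g0 gz0.
pose G := g z1.
have G0 : 0 < G.
  have : 0 < d1 * g z1 by apply: lt_le_trans le1; exact: mulr_gt0.
  by rewrite pmulr_rgt0.
(* if [G] is small at its own scale, the bound is immediate *)
have [small|big] := leP (d1 * G) (lam * s).
  have : r0 * g z0 <= lam * s by exact: le_trans le1 small.
  rewrite /r0 mulrAC ler_pdivrMr// mulrC => H.
  have : g z0 <= lam * 16.
    by rewrite -(ler_pM2r sp); apply: le_trans H _; rewrite mulrAC.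
  by move: k0; clear => *; lra.
have Gk : G <= 4 * k; last first.
  have H : r0 * g z0 <= r0 * (4 * k).
    exact: le_trans le1 (ler_pM (ltW d10) (g0 z1) d1r Gk).
  by rewrite ler_pM2l// in H; move: H lam0; clear => *; lra.
pose l := lam * s / (2 * G).
have l0 : 0 < l by rewrite divr_gt0 ?mulr_gt0.
have ld1 : l <= d1 / 2.
  rewrite /l ler_pdivrMr ?mulr_gt0//; apply: le_trans (ltW big) _.
  by rewrite le_eqVlt; apply/orP; left; apply/eqP; field.
have sub z : box z1 l z -> box z0 r0 z /\ g z <= 2 * G.
  by move=> [h1 h2]; apply: Hb; split; exact: le_trans ld1.
have BD : box z1 l `<=` unit_disc by move=> z /sub[/inD[]].
have NG z : box z1 l z -> gradsq w z <= (2 * G) ^+ 2.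
  by move=> /sub[_ h]; rewrite gg ler_pXn2r// nnegrE// mulr_ge0// ltW.
have dT z : box z1 l z -> pdist P (w z) <= 2 * A * s.
  move=> /sub[/inD[Dz h1 h2] _]; apply: le_trans (Hdec z Dz h1) _.
  by rewrite [2 * A]mulrC -mulrA ler_pM2l.
have := gradient_at_doubling (ltW C0) HP B0 (ltW K0) K'0 Hw l0 BD G0 (gg z1) NG
  (dpos _ (BD _ (box_center z1 (ltW l0)))) dT.
rewrite kE.
have Gl : 8 * G * l = 4 * lam * s by rewrite /l; field; rewrite gt_eqF.
have -> : 2 * (2 * A * s) + 8 * G * l = (4 * A + 4 * lam) * s.
  by rewrite Gl; ring.
have -> : C * ((4 * A + 4 * lam) * s) ^+ 2 = c1 * s * s by rewrite /c1; ring.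
have -> : (8 * B + 1) * G ^+ 2 * l / 2 = (8 * B + 1) * lam * s * G / 4.
  by rewrite /l; field; rewrite gt_eqF.
have S1 : 2 * (2 * A * s + c1 * s * s) / l <= 16 * A * G / lam.
  have -> : 16 * A * G / lam = 2 * (2 * A * s + 2 * A * s) / l.
    by rewrite /l; field; rewrite !gt_eqF.
  rewrite ler_pM2r ?invr_gt0// ler_pM2l// lerD2l.
  by rewrite ler_pM2r.
have S2 : 3 * K * (16 * A * G / lam) = G / 4.
  by rewrite /lam; field; rewrite !gt_eqF.
have S3 : 3 * K * ((8 * B + 1) * lam * s * G / 4) <= G / 4.
  have -> : 3 * K * ((8 * B + 1) * lam * s * G / 4) = c2 * s * (G / 4).
    by rewrite /c2; ring.
  by rewrite -[leRHS]mul1r ler_wpM2r// divr_ge0// ltW.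
have K3 : 0 < 3 * K by rewrite mulr_gt0.
rewrite -(ler_pM2l K3) S2 in S1.
rewrite mulrDr.
move: S1 S3; clear.
generalize (3 * K * (2 * (2 * A * s + c1 * s * s) / l)),
  (3 * K * ((8 * B + 1) * lam * s * G / 4)) => *; lra.
Qed.

Lemma gradient_bounded gamma w P (C K K' B : R) :
  0 < C -> projects_onto gamma C P -> 0 <= B -> 1 <= K -> 0 <= K' ->
  pde_controlled unit_disc w K K' B ->
  (forall z, unit_disc z -> 0 < pdist P (w z)) ->
  (forall eps, 0 < eps ->
     compact (unit_disc `&` [set z | eps <= pdist P (w z)])) ->
  exists M : R, forall z, unit_disc z -> gradsq w z <= M.
Proof.
move=> C0 HP B0 K1 K'0 Hw dpos dcpt.
have [A [s0 [A0 s00 Hdec]]] := boundary_decay C0 HP Hw B0 K'0 dpos dcpt.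
have [M [s1 [s10 HM]]] :=
  gradient_bounded_near_boundary C0 HP B0 K1 K'0 Hw dpos A0 s00 Hdec.
have [Cw1 _ _] := class_C2_C1 Hw.1.
pose S : set (R * R) := box 0 1 `&` (@depth R @^-1` [set t | s1 <= t]).
have cS : compact S.
  apply: compact_closedI; first exact: box_compact.
  apply: preimage_closed; last exact: closed_ge.
  by move=> z _; exact: depth_continuous.
have SD z : S z -> unit_disc z.
  by move=> [_ /= h]; apply/unit_disc_depth; exact: lt_le_trans h.
have DS z : unit_disc z -> s1 <= depth z -> S z.
  move=> Dz h; split=> //; rewrite /unit_disc/= in Dz.
  by have [h1 h2] := cabs_comp z; split; rewrite /= subr0; lra.
have [S0|S0] := pselect (S !=set0); last first.
  exists M => z Dz; apply: HM => //; rewrite leNgt; apply/negP => h.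
  by apply: S0; exists z; apply: DS => //; exact: ltW.
have cg : {within S, continuous (gradsq w)}.
  apply: continuous_in_subspaceT => z; rewrite inE => /SD Dz.
  exact: gradsq_continuous Cw1 Dz.
have [z2 _ Hmax] := compact_EVT_max S0 cS cg.
exists (Num.max M (gradsq w z2)) => z Dz.
have [h|h] := leP (depth z) s1; first by rewrite le_max HM.
by rewrite le_max Hmax ?orbT// inE; apply: DS => //; exact: ltW.
Qed.

End UniformGradientBound.

(** * Bounded partials and Lipschitz continuity *)

Section Assembly.
Context {R : realType}.
Implicit Types (z : R * R) (D Omega : set (R * R)) (w P : R * R -> R * R).

Lemma between_sqr (a b t : R) : Num.min a b <= t <= Num.max a b ->
  t ^+ 2 <= Num.max (a ^+ 2) (b ^+ 2).
Proof.
move=> /andP[h1 h2]; rewrite le_max.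
have mono (s u : R) : `|s| <= `|u| -> s ^+ 2 <= u ^+ 2.
  by move=> h; rewrite -(real_normK (num_real s)) -(real_normK (num_real u))
    ler_pXn2r// nnegrE.
have [t0|t0] := leP 0 t.
  move: h2; rewrite le_max => /orP[h|h]; apply/orP; [left|right];
    by apply: mono; rewrite !ger0_norm//; lra.
move: h1; rewrite ge_min => /orP[h|h]; apply/orP; [left|right];
  by apply: mono; rewrite !ler0_norm//; lra.
Qed.

Lemma disc_corner_path w (g : R) : class_C 1 unit_disc w -> 0 <= g ->
  (forall z, unit_disc z -> gradsq w z <= g ^+ 2) ->
  forall x y x' y', unit_disc (x, y) -> unit_disc (x', y') ->
    unit_disc (x, y') ->
    cabs (w (x, y) - w (x', y')) <= 2 * g * (`|x - x'| + `|y - y'|).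
Proof.
move=> Cw g0 Ng x y x' y' D1 D2 D3.
apply: (corner_path_bound Cw (@subset_refl _ _) g0 Ng) => t /between_sqr;
  rewrite le_max => ht; apply/unit_disc_depth.
- move: D2 D3 => /unit_disc_depth D2 /unit_disc_depth D3; move: D2 D3.
  by rewrite /depth/=; case/orP: ht; lra.
- move: D1 D3 => /unit_disc_depth D1 /unit_disc_depth D3; move: D1 D3.
  by rewrite /depth/=; case/orP: ht; lra.
Qed.

(** One of the two corners of the rectangle with opposite vertices [z1], [z2]
    lies in the disc, because the squared moduli of the corners have the same
    sum as those of [z1] and [z2]. *)
Lemma disc_lipschitz w (M : R) : class_C 1 unit_disc w ->
  (forall z, unit_disc z -> gradsq w z <= M) ->
  exists L : R, forall z1 z2, unit_disc z1 -> unit_disc z2 ->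
    cabs (w z1 - w z2) <= L * cabs (z1 - z2).
Proof.
move=> Cw HM; pose g := Num.sqrt (Num.max 0 M).
have g0 : 0 <= g by exact: sqrtr_ge0.
have Ng z : unit_disc z -> gradsq w z <= g ^+ 2.
  by move=> /HM h; rewrite sqr_sqrtr ?le_max ?lexx// h orbT.
have S := disc_corner_path Cw g0 Ng.
have fin (z1 z2 : R * R) : 2 * g * (`|z1.1 - z2.1| + `|z1.2 - z2.2|) <=
    4 * g * cabs (z1 - z2).
  have [/= h1 h2] := cabs_comp (z1 - z2).
  have -> : 4 * g * cabs (z1 - z2) = 2 * g * (cabs (z1 - z2) + cabs (z1 - z2)).
    by ring.
  by rewrite ler_wpM2l ?mulr_ge0// lerD.
exists (4 * g) => -[x y] [x' y'] D1 D2.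
have [c|c] := pselect (unit_disc (x, y')).
  by apply: le_trans (fin _ _); exact: S.
rewrite cabsB (cabsB (x, y)); apply: le_trans (fin _ _); apply: S => //.
apply/unit_disc_depth; rewrite ltNge; apply/negP => c'; apply: c.
apply/unit_disc_depth; move: D1 D2 => /unit_disc_depth D1 /unit_disc_depth D2.
by move: D1 D2 c'; rewrite /depth/=; lra.
Qed.

Lemma bounded_set_box D : bounded_set D -> exists l : R, D `<=` box 0 l.
Proof.
move=> [M [_ HM]]; exists (M + 1) => z Dz.
have : `|z| <= M + 1 by apply: HM => //; rewrite ltrDl.
by rewrite prod_normE ge_max => /andP[h1 h2]; split; rewrite /= subr0.
Qed.

(** A limit of such points lies in the closure of [Omega] and off the boundary,
    hence in [Omega]. *)
Lemma inner_set_compact Omega (C : R) P (eps : R) : bounded_set Omega ->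
  projects_onto (boundary Omega) C P -> 0 < eps ->
  compact (Omega `&` [set z | eps <= pdist P z]).
Proof.
move=> /bounded_set_box[l Hl] HP e0.
have -> : Omega `&` [set z | eps <= pdist P z] =
    box 0 l `&` (closure Omega `&` (pdist P @^-1` [set t | eps <= t])).
  apply/seteqP; split=> z.
    by move=> [Oz hz]; split; [exact: Hl|split=> //; exact: subset_closure].
  move=> [_ [cz hz]]; split=> //; apply: contrapT => nO.
  have gz : boundary Omega z by split=> // /interior_subset.
  have [_ H _] := HP z; have := H _ gz.
  rewrite subrr /cabs /= expr0n addr0 sqrtr0 => h.
  by have := lt_le_trans e0 (le_trans hz h); rewrite ltxx.
apply: compact_closedI; first exact: box_compact.
apply: closedI; first exact: closed_closure.
apply: preimage_closed; last exact: closed_ge.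
by move=> z _; exact: (pdist_continuous HP).
Qed.

Lemma pdist_gt0_of_open Omega (C : R) P z : open Omega ->
  projects_onto (boundary Omega) C P -> Omega z -> 0 < pdist P z.
Proof.
move=> oO HP Oz; apply: cabs_gt0 => E.
have [[_ nint] _ _] := HP z; apply: nint; rewrite -E.
exact: (open_nbhs_nbhs (conj oO Oz)).
Qed.

Lemma cabs_partials_le w (M : R) z : gradsq w z <= M ->
  cabs (dx w z) <= Num.sqrt M /\ cabs (dy w z) <= Num.sqrt M.
Proof.
move=> h; have M0 := le_trans (gradsq_ge0 w z) h.
split; rewrite -(@ler_pXn2r _ 2)// ?nnegrE ?cabs_ge0 ?sqrtr_ge0//;
  rewrite cabs_sqr (sqr_sqrtr M0); apply: le_trans h.
- by rewrite /gradsq -addrA lerDl addr_ge0// sqr_ge0.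
- by rewrite /gradsq -[leRHS]addrA lerDr addr_ge0// sqr_ge0.
Qed.

End Assembly.

Theorem corollary1p2 (R : realType) (alpha : R) (Omega : set (R * R))
    (rho : R * R -> R) (K K' : R) (w : R * R -> R * R)
    (halpha : 0 < alpha <= 1)
    (hOmega : Cna_Jordan_domain 2 alpha Omega)
    (hrho : conformal_C1_metric Omega rho)
    (hrho_aa : approximately_analytic Omega (real_valued rho))
    (hK : 1 <= K) (hK' : 0 <= K')
    (hharm : rho_harmonic rho unit_disc Omega w)
    (honto : w @` unit_disc = Omega)
    (hproper : proper_map unit_disc Omega w)
    (hqr : quasiregular K K' unit_disc Omega w) :
  (exists M : R, forall z, unit_disc z ->
      cabs (dx w z) <= M /\ cabs (dy w z) <= M) /\
  (exists L : R, forall z1 z2, unit_disc z1 -> unit_disc z2 ->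
      cabs (w z1 - w z2) <= L * cabs (z1 - z2)).
Proof.
have [[oO _ _] bO /smooth_curve_projection[C C0 [P HP]]] := hOmega.
have oD := @unit_disc_open R.
have [B B0 HB] := harmonic_laplacian_bound oD hrho hrho_aa hharm.
have [wD Cw _] := hharm; have [_ _ _ _ [_ hae]] := hqr.
have [Cw1 _ _] := class_C2_C1 Cw.
have Hq := quasiregular_everywhere oD Cw1 hae.
have inO z : unit_disc z -> Omega (w z) by move=> Dz; apply: wD; exists z.
have Hw : pde_controlled unit_disc w K K' B.
  by split=> // z Dz; have [h1 h2] := HB z Dz; split=> //; exact: Hq.
have dpos z : unit_disc z -> 0 < pdist P (w z).
  by move=> /inO; exact: pdist_gt0_of_open oO HP.
have dcpt eps : 0 < eps ->
    compact (unit_disc `&` [set z | eps <= pdist P (w z)]).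
  move=> e0; have [_ prop] := hproper.
  have := prop _ (inner_set_compact bO HP e0) (@subIsetl _ _ _).
  congr compact; apply/seteqP; split=> z; first by move=> [Dz [_ h]].
  by move=> [Dz h]; split=> //; split=> //; exact: inO.
have [M HM] := gradient_bounded C0 HP B0 hK hK' Hw dpos dcpt.
split; last exact: disc_lipschitz Cw1 HM.
by exists (Num.sqrt M) => z /HM; exact: cabs_partials_le.
Qed.
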